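(* Let $f$ be strongly convex with parameter $\mu>0$ and have Lipschitz gradient with parameter $L$ (with respect to the $\pi$-norm). Fix a level $m$ and a step size $\gamma>0$, let $u^1\in l^2_m$, and let $u^{k+1}=u^k-\gamma g_k$ for $k\ge1$, where $g_k\in l^2_m$ is a random estimate, satisfying the following, of the truncated gradient $D_mf(x^k(\theta),\theta)$ at the function $x^k$ with coefficient sequence $u^k$: conditionally on the randomness used in the previous steps, $g_k$ is unbiased, and there are constants $C_G\ge1$, $C\ge0$ (with equality in the case of zero variance) such that the conditional second moment satisfies $$\mathbb E\big(\|g_k\|_2^2\,\big|\,\text{past}\big)\le C+C_G\,\|\nabla f(x^k(\theta),\theta)-\nabla f(x^*_m(\theta),\theta)\|_\pi^2 .$$ If $\gamma\le\dfrac{2}{(\mu+L)C_G}$, then for all $k\ge 1$ $$\mathbb E\|u^{k+1}-u_m^*\|_2^2\le\Big(1-\frac{2\gamma\mu L}{\mu+L}\Big)^k\Big(\|u^1-u_m^*\|_2^2-\frac{(\mu+L)\gamma^2C}{2\gamma\mu L}\Big)+\frac{(\mu+L)\gamma^2C}{2\gamma\mu L},$$ where the expectation is over the randomness of the first $k$ steps and $u^*_m$ is the level $m$ optimum.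
   Context: Let $\pi$ be a probability measure on $\Theta\subset\mathbb R^d$ and $q\ge1$. $L^2_\pi$ is the space of functions $x:\Theta\to\mathbb R^q$ with $\|x\|_\pi^2=\langle x,x\rangle_\pi<\infty$, where $\langle x,y\rangle_\pi=\int_\Theta x(\theta)\cdot y(\theta)\,\pi(d\theta)$. Fix an orthonormal basis $(B_i)_{i\ge1}$ of the real-valued square-integrable functions with respect to $\pi$. Each $x\in L^2_\pi$ is identified isometrically with its coefficient sequence $u=\mathcal I(x)\in l^2$, $u_i=\int_\Theta x(\theta)B_i(\theta)\pi(d\theta)\in\mathbb R^q$, $\|u\|_2^2=\sum_i|u_i|^2$. $l^2_m$ is the set of $u\in l^2$ with $u_i=0$ for $i>m$. The objective is $f(x(\theta),\theta)$, differentiable in its first argument; $\nabla f$ is the gradient in the first argument, with $\nabla f(x(\cdot),\cdot)\in L^2_\pi$ for $x\in L^2_\pi$. Strong convexity with parameter $\mu$: $\langle \nabla f(x_1(\theta),\theta)-\nabla f(x_2(\theta),\theta),x_1(\theta)-x_2(\theta)\rangle_\pi\ge\mu\|x_1-x_2\|_\pi^2$ for all $x_1,x_2\in L^2_\pi$. Lipschitz gradient with parameter $L$: $\|\nabla f(x_1(\theta),\theta)-\nabla f(x_2(\theta),\theta)\|_\pi\le L\|x_1-x_2\|_\pi$ for all $x_1,x_2\in L^2_\pi$. The truncated gradient $D_mf(x(\theta),\theta)\in l^2_m$ has $i$-th entry $\int_\Theta\nabla f(x(\theta),\theta)B_i(\theta)\pi(d\theta)$ for $i\le m$ and $0$ for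 $i>m$. The level $m$ optimum $u_m^*\in l^2_m$, with corresponding function $x_m^*$, is the unique element with $D_mf(x^*_m(\theta),\theta)=0$. ''Unbiased given the past'' means: with $\mathcal G_{k}$ the $\sigma$-algebra generated by the random variables used to form $g_1,\dots,g_{k-1}$ (so $u^k$ is $\mathcal G_k$-measurable), $\mathbb E(g_k\mid\mathcal G_k)=D_mf(x^k(\theta),\theta)$; the second-moment bound is likewise conditional on $\mathcal G_k$. $u^1$ is deterministic. *)

(* Defs.v *)
From HB Require Import structures.
From mathcomp Require Export all_boot all_order all_algebra.
From mathcomp Require Export all_classical all_reals all_analysis.
From mathcomp Require Export measurable_realfun.

Set Implicit Arguments.
Unset Strict Implicit.
Unset Printing Implicit Defensive.

Export Order.TTheory GRing.Theory Num.Theory.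
Export numFieldNormedType.Exports.

Open Scope classical_set_scope.
Open Scope ring_scope.

(* A subset of a measurable space, as a type with the trace sigma-algebra. The
   base point [t0] is there because measurable types are pointed; no
   measurability of the subset is required. *)
Definition pointed_subset {T : choiceType} {D : set T} (t0 : D) : Type := D.

HB.instance Definition _ (T : choiceType) (D : set T) (t0 : D) :=
  Choice.copy (pointed_subset t0) D.
HB.instance Definition _ (T : choiceType) (D : set T) (t0 : D) :=
  isPointed.Build (pointed_subset t0) t0.

Definition subset_incl {T : choiceType} {D : set T} (t0 : D)
  (t : pointed_subset t0) : T := \val (t : D).

Definition trace_type {d : measure_display} {T : measurableType d} {D : set T}
    (t0 : D) : measurableType (preimage_display (@subset_incl T D t0)) :=
  g_sigma_algebra_preimageType (@subset_incl T D t0).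

Section euclidean.
Context {R : realType} {q : nat}.

Definition dot (v w : 'rV[R]_q) : R := \sum_(j < q) v 0 j * w 0 j.

(* [|u|_2^2], in [\bar R] since a general sequence need not be in [l^2]. *)
Definition l2normsq (u : nat -> 'rV[R]_q) : \bar R :=
  (\sum_(0 <= i <oo) (dot (u i) (u i))%:E)%E.

(* Coefficient sequences are indexed from 0, so that [l^2_m] is the set of
   sequences vanishing at the indices [i >= m]. *)
Definition l2_level (m : nat) (u : nat -> 'rV[R]_q) : Prop :=
  (l2normsq u < +oo)%E /\ forall i, (m <= i)%N -> u i = 0.

End euclidean.

Section parametric_objective.
Context {d : measure_display} {T : measurableType d} {R : realType}.
Variable pi : probability T R.

Definition orthonormal_basis (B : nat -> T -> R) : Prop :=
  [/\ forall i, B i \in Lfun pi 2%:E,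
      forall i j, \int[pi]_t (B i t * B j t) = (i == j)%:R
    & forall h, h \in Lfun pi 2%:E ->
        (fun n => \int[pi]_t
           (h t - \sum_(i < n) (\int[pi]_s (h s * B i s)) * B i t) ^+ 2)
          @ \oo --> (0 : R)].

Context {q : nat}.

Definition L2 (x : T -> 'rV[R]_q) : Prop :=
  (forall j, measurable_fun setT (fun t => x t 0 j)) /\
  (\int[pi]_t (dot (x t) (x t))%:E < +oo)%E.

Definition inner (x y : T -> 'rV[R]_q) : R := \int[pi]_t dot (x t) (y t).

Definition norm_pi (x : T -> 'rV[R]_q) : R := Num.sqrt (inner x x).

Definition coef (B : nat -> T -> R) (x : T -> 'rV[R]_q) (i : nat) : 'rV[R]_q :=
  \row_(j < q) \int[pi]_t (x t 0 j * B i t).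

(* [has_coef B x u]: [x] is a function in [L^2_pi] with coefficients [u]; this
   determines [x] up to a [pi]-null set. *)
Definition has_coef (B : nat -> T -> R) (x : T -> 'rV[R]_q)
    (u : nat -> 'rV[R]_q) : Prop :=
  L2 x /\ coef B x = u.

Variable f : 'rV[R]_q -> T -> R.

Definition grad (y : 'rV[R]_q) (t : T) : 'rV[R]_q :=
  \row_(j < q) 'D_(delta_mx 0 j) (f ^~ t) y.

Definition grad_at (x : T -> 'rV[R]_q) : T -> 'rV[R]_q :=
  fun t => grad (x t) t.

Definition strongly_convex (mu : R) : Prop :=
  forall x1 x2, L2 x1 -> L2 x2 ->
    mu * norm_pi (x1 \- x2) ^+ 2 <=
      inner (grad_at x1 \- grad_at x2) (x1 \- x2).

Definition lipschitz_gradient (L : R) : Prop :=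
  forall x1 x2, L2 x1 -> L2 x2 ->
    norm_pi (grad_at x1 \- grad_at x2) <= L * norm_pi (x1 \- x2).

Definition trunc_grad (B : nat -> T -> R) (m : nat) (x : T -> 'rV[R]_q) :
    nat -> 'rV[R]_q :=
  fun i => if (i < m)%N then coef B (grad_at x) i else 0.

Definition level_optimum (B : nat -> T -> R) (m : nat)
    (us : nat -> 'rV[R]_q) (xs : T -> 'rV[R]_q) : Prop :=
  [/\ l2_level m us, has_coef B xs us, trunc_grad B m xs = (fun=> 0)
    & forall u x, l2_level m u -> has_coef B x u ->
        trunc_grad B m x = (fun=> 0) -> u = us].

End parametric_objective.

Section conditional_expectation.
Context {d : measure_display} {W : measurableType d} {R : realType}.
Variables (P : probability W R) (G : set (set W)).

Definition measurable_wrt {d' : measure_display} {S : measurableType d'}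
    (Y : W -> S) : Prop :=
  forall A, measurable A -> G (Y @^-1` A).

Definition is_cond_exp (X Y : W -> R) : Prop :=
  [/\ P.-integrable setT (EFin \o X), P.-integrable setT (EFin \o Y),
      measurable_wrt Y
    & forall A, G A -> \int[P]_(w in A) X w = \int[P]_(w in A) Y w].

(* The conditional expectation of a nonnegative, possibly non-integrable,
   random variable. *)
Definition is_cond_exp_ge0 (X Y : W -> \bar R) : Prop :=
  [/\ measurable_fun setT X, forall w, (0 <= X w)%E, forall w, (0 <= Y w)%E,
      measurable_wrt Y
    & forall A, G A -> (\int[P]_(w in A) X w = \int[P]_(w in A) Y w)%E].

End conditional_expectation.

(* The sigma-algebra generated by [xi 1, ..., xi k.-1]. *)
Definition past {W : Type} {dS : nat -> measure_display}
    {S : forall j, measurableType (dS j)} (xi : forall j, W -> S j) (k : nat) :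
    set (set W) :=
  <<s \bigcup_(j in [set j | (0 < j < k)%N])
        preimage_set_system setT (xi j) measurable >>.

(* Main.v *)
Require Import Defs.
From mathcomp Require Import ring lra.

(** The strong convexity and Lipschitz hypotheses are integrated over [Theta],
    but gluing two functions along a measurable set turns them into pointwise
    almost-everywhere inequalities for each pair of functions in [L^2_pi].
    A mean value point produced by bisection depends measurably on [theta], so
    these inequalities apply to it and give the usual quadratic lower and upper
    bounds on [f], hence the cocoercivity inequality
    [|D|^2 + mu L |h|^2 <= (mu + L) <D, h>] with [h := x1 - x2] and
    [D := grad f x1 - grad f x2], almost everywhere and then in [L^2_pi].
    A function whose coefficients vanish from index [m] on is a finite
    combination of the [B i], so at [x1 := x^k] and [x2 := x_m^*] the inner
    product [<D, h>] is the pairing of [u^k - u_m^*] with the truncated gradient.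
    Unbiasedness (the error is measurable with respect to the past) and the
    moment bound then give
    [E_{k+1} <= (1 - 2 gamma mu L / (mu + L)) E_k + gamma^2 C], which is iterated. *)

Set Implicit Arguments.
Unset Strict Implicit.
Unset Printing Implicit Defensive.

(** * Integrable real functions, the inner product and [L^2_pi] *)

Section real_integrable.
Context {d : measure_display} {T : measurableType d} {R : realType}.
Variable mu : {measure set T -> \bar R}.
Implicit Types f g : T -> R.

Local Notation integ f := (mu.-integrable setT (EFin \o f)).

Lemma integ_eq f g : f =1 g -> integ f -> integ g.
Proof. by move=> /funext ->. Qed.

Lemma integ_meas f : integ f -> measurable_fun setT f.
Proof. by move=> /measurable_int /measurable_EFinP. Qed.

Lemma integD f g : integ f -> integ g -> integ (fun t => f t + g t).
Proof. by move=> fi gi; have := integrableD measurableT fi gi. Qed.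

Lemma integB f g : integ f -> integ g -> integ (fun t => f t - g t).
Proof. by move=> fi gi; have := integrableB measurableT fi gi. Qed.

Lemma integZl (c : R) f : integ f -> integ (fun t => c * f t).
Proof. by move=> fi; have := integrableZl measurableT c fi. Qed.

Lemma integ_sum (I : Type) (r : seq I) (h : I -> T -> R) :
  (forall i, integ (h i)) -> integ (fun t => \sum_(i <- r) h i t).
Proof.
move=> hi; rewrite (_ : EFin \o _ = fun t => \sum_(i <- r) (h i t)%:E)%E.
  exact: (@integrable_sum _ _ _ mu setT measurableT _ _ _ (fun i => EFin \o h i)).
by apply/funext => t /=; rewrite sumEFin.
Qed.

Lemma integ_le f g : measurable_fun setT f -> integ g ->
  (forall t, `|f t| <= g t) -> integ f.
Proof.
move=> mf gi fg; apply: (le_integrable measurableT _ _ gi) => /=.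
  exact/measurable_EFinP.
by move=> t _; rewrite lee_fin (le_trans (fg t))// ler_norm.
Qed.

Lemma integ_bounded_mul f g : measurable_fun setT f ->
  (forall t, `|f t| <= 1) -> integ g -> integ (fun t => f t * g t).
Proof.
move=> mf f1 gi.
apply: (@integ_le _ (fun t => `|g t|)).
- by apply: measurable_funM => //; exact: integ_meas.
- by have := integrable_norm gi.
- by move=> t; rewrite normrM ler_piMl.
Qed.

Lemma integ_indic_mul (A : set T) g : measurable A -> integ g ->
  integ (fun t => \1_A t * g t).
Proof.
move=> mA; apply: integ_bounded_mul => // t.
by rewrite indicE; case: (_ \in _); rewrite ?normr1 ?normr0.
Qed.

Lemma Rint_sum (I : Type) (r : seq I) (h : I -> T -> R) :
  (forall i, integ (h i)) ->
  \int[mu]_t (\sum_(i <- r) h i t) = \sum_(i <- r) \int[mu]_t h i t.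
Proof.
move=> hi; elim: r => [|i r IH].
  rewrite big_nil; under eq_Rintegral do rewrite big_nil.
  by rewrite Rintegral_cst// mul0r.
rewrite big_cons -IH; under eq_Rintegral do rewrite big_cons.
by rewrite RintegralD//; exact: integ_sum.
Qed.

Lemma ae_eq_Rint f g : integ f -> integ g ->
  {ae mu, forall t, f t = g t} -> \int[mu]_t f t = \int[mu]_t g t.
Proof.
move=> fi gi fg; congr fine; apply: ae_eq_integral => //.
- exact: measurable_int fi.
- exact: measurable_int gi.
- by apply: filterS fg => t /= -> _.
Qed.

Lemma ae_le_Rint f g : integ f -> integ g ->
  {ae mu, forall t, f t <= g t} -> \int[mu]_t f t <= \int[mu]_t g t.
Proof.
move=> fi gi fg; rewrite -subr_ge0 -RintegralB//.
rewrite (@ae_eq_Rint _ (fun t => `|g t - f t|)).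
- exact: Rintegral_ge0.
- exact: integB.
- by have := integrable_norm (integB gi fi).
- by apply: filterS fg => t ft; rewrite ger0_norm// subr_ge0.
Qed.

Lemma Rint_eq0_ae f : integ f -> (forall t, 0 <= f t) ->
  \int[mu]_t f t = 0 -> {ae mu, forall t, f t = 0}.
Proof.
move=> fi f0 If.
have mf := measurable_int mu fi.
have : (\int[mu]_t `|(EFin \o f) t| = 0)%E.
  transitivity (\int[mu]_t (f t)%:E)%E.
    by apply: eq_integral => t _ /=; rewrite ger0_norm.
  by rewrite -[LHS]fineK ?(integrable_fin_num _ fi)//; congr EFin.
move=> /(ae_eq_integral_abs mu measurableT mf); apply: filterS => t /(_ I) /=.
by case.
Qed.

(** Test the hypothesis on the set where [f < 0]: there [\1_A * f] is nonpositive with nonnegative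
    integral, hence zero almost everywhere. This is what turns integrated inequalities into
    pointwise ones. *)
Lemma ae_ge0_of_Rint_indic f : integ f ->
  (forall A, measurable A -> 0 <= \int[mu]_t (\1_A t * f t)) ->
  {ae mu, forall t, 0 <= f t}.
Proof.
move=> fi fA.
have mf := integ_meas fi.
pose A := [set t | f t < 0].
have mA : measurable A.
  rewrite (_ : A = setT `&` f @^-1` [set` `]-oo, 0[]); first exact: mf.
  by apply/seteqP; split => t /=; rewrite in_itv/= => // -[].
have iA : integ (fun t => \1_A t * f t) by exact: integ_indic_mul.
have Af : forall t, 0 <= - (\1_A t * f t).
  move=> t; rewrite indicE; case: (boolP (t \in A)); rewrite ?mul0r ?oppr0//.
  by rewrite inE /A /= mul1r oppr_ge0 => /ltW.
have iAN : integ (fun t => - (\1_A t * f t)).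
  by apply: integ_eq (integZl (-1) iA) => t; rewrite mulN1r.
have : {ae mu, forall t, - (\1_A t * f t) = 0}.
  apply: Rint_eq0_ae => //; apply/eqP; rewrite eq_le Rintegral_ge0// andbT.
  under eq_Rintegral do rewrite -mulN1r.
  by rewrite RintegralZl// mulN1r oppr_le0 fA.
apply: filterS => t /eqP; rewrite oppr_eq0 indicE.
case: (boolP (t \in A)) => [|].
  by rewrite mul1r => _ /eqP ->.
by rewrite notin_setE /A /= => /negP; rewrite -leNgt.
Qed.

End real_integrable.

Section dot_theory.
Context {R : realType} {q : nat}.
Implicit Types v w z : 'rV[R]_q.

Lemma dotC v w : dot v w = dot w v.
Proof. by apply: eq_bigr => j _; rewrite mulrC. Qed.

Lemma dotDl v w z : dot (v + w) z = dot v z + dot w z.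
Proof. by rewrite /dot -big_split; apply: eq_bigr => j _; rewrite mxE mulrDl. Qed.

Lemma dotZl c v w : dot (c *: v) w = c * dot v w.
Proof. by rewrite /dot mulr_sumr; apply: eq_bigr => j _; rewrite mxE mulrA. Qed.

Lemma dotNl v w : dot (- v) w = - dot v w.
Proof. by rewrite -scaleN1r dotZl mulN1r. Qed.

Lemma dotDr v w z : dot z (v + w) = dot z v + dot z w.
Proof. by rewrite dotC dotDl !(dotC z). Qed.

Lemma dotZr c v w : dot w (c *: v) = c * dot w v.
Proof. by rewrite dotC dotZl dotC. Qed.

Lemma dotNr v w : dot w (- v) = - dot w v.
Proof. by rewrite dotC dotNl dotC. Qed.

Definition dotE := (dotDl, dotDr, dotNl, dotNr, dotZl, dotZr).

Lemma dot_ge0 v : 0 <= dot v v.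
Proof. by apply: sumr_ge0 => j _; rewrite -expr2 sqr_ge0. Qed.

Lemma dot0l v : dot 0 v = 0.
Proof. by rewrite -(scale0r 0) dotZl mul0r. Qed.

(** A crude Cauchy-Schwarz bound from [|v + w|^2 >= 0] and [|v - w|^2 >= 0], sufficient to dominate
    integrands. *)
Lemma normr_dot_le v w : `|dot v w| <= dot v v + dot w w.
Proof.
have := dot_ge0 (v + w); have := dot_ge0 (v - w).
have := dot_ge0 v; have := dot_ge0 w.
rewrite !dotE (dotC w v) ler_norml => ? ? ? ?; apply/andP; split; lra.
Qed.

Lemma sqr_coord_le_dot v j : v 0 j ^+ 2 <= dot v v.
Proof.
by rewrite /dot (bigD1 j)//= -expr2 lerDl sumr_ge0// => i _; rewrite -expr2 sqr_ge0.
Qed.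

End dot_theory.

Section L2_theory.
Context {d : measure_display} {T : measurableType d} {R : realType} {q : nat}.
Variable pi : probability T R.
Implicit Types x y h : T -> 'rV[R]_q.

Local Notation integ f := (pi.-integrable setT (EFin \o f)).

Lemma measurable_dot x y :
  (forall j, measurable_fun setT (fun t => x t 0 j)) ->
  (forall j, measurable_fun setT (fun t => y t 0 j)) ->
  measurable_fun setT (fun t => dot (x t) (y t)).
Proof.
by move=> mx my; apply: measurable_sum => j; exact: measurable_funM.
Qed.

Lemma L2P x : L2 pi x <->
  (forall j, measurable_fun setT (fun t => x t 0 j)) /\
  integ (fun t => dot (x t) (x t)).
Proof.
split=> -[mx xi]; split => //.
  apply/integrableP; split; first exact/measurable_EFinP/measurable_dot.
  rewrite (eq_integral (fun t => (dot (x t) (x t))%:E))// => t _ /=.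
  by rewrite ger0_norm// dot_ge0.
have /integrableP[_] := xi.
rewrite (eq_integral (fun t => (dot (x t) (x t))%:E))// => t _ /=.
by rewrite ger0_norm// dot_ge0.
Qed.

Lemma L2_dot_integrable x y : L2 pi x -> L2 pi y ->
  integ (fun t => dot (x t) (y t)).
Proof.
move=> /L2P[mx xi] /L2P[my yi].
apply: (integ_le _ (integD xi yi)); first exact: measurable_dot.
by move=> t; exact: normr_dot_le.
Qed.

(** The parallelogram law gives the dominating function [2 |x|^2 + 2 |h|^2]. The weight [b] varies
    with the parameter: it will be an indicator when two functions are glued, and a mean value point
    in the quadratic bounds. *)
Lemma L2_segment x h (b : T -> R) : L2 pi x -> L2 pi h ->
  measurable_fun setT b -> (forall t, 0 <= b t <= 1) ->
  L2 pi (fun t => x t + b t *: h t).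
Proof.
move=> /[dup] xL /L2P[mx xi] /[dup] hL /L2P[mh hi] mb b01.
have m j : measurable_fun setT (fun t => (x t + b t *: h t) 0 j).
  rewrite (_ : (fun t => _) = fun t => x t 0 j + b t * h t 0 j).
    by apply: measurable_funD => //; exact: measurable_funM.
  by apply/funext => t; rewrite !mxE.
apply/L2P; split => //.
apply: (integ_le _ (integD (integZl 2 xi) (integZl 2 hi))).
  exact: measurable_dot.
move=> t; rewrite ger0_norm ?dot_ge0//.
have /andP[b0 b1] := b01 t.
have := dot_ge0 (x t - b t *: h t).
rewrite !dotE (dotC (h t)).
have b2 : b t * b t <= 1 by rewrite mulr_ile1.
have := ler_wpM2r (dot_ge0 (h t)) b2.
lra.
Qed.

Lemma L2Z c x : L2 pi x -> L2 pi (fun t => c *: x t).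
Proof.
move=> /L2P[mx xi]; apply/L2P; split.
  move=> j; rewrite (_ : (fun t => _) = fun t => c * x t 0 j).
    by apply: measurable_funM => //; exact: measurable_cst.
  by apply/funext => t; rewrite !mxE.
by apply: integ_eq (integZl (c ^+ 2) xi) => t; rewrite !dotE mulrA.
Qed.

Lemma L2D x y : L2 pi x -> L2 pi y -> L2 pi (fun t => x t + y t).
Proof.
move=> xL yL.
rewrite (_ : (fun t => _) = fun t => x t + cst 1 t *: y t).
  by apply: L2_segment => // t; rewrite lexx ler01.
by apply/funext => t; rewrite scale1r.
Qed.

Lemma L2B x y : L2 pi x -> L2 pi y -> L2 pi (fun t => x t - y t).
Proof.
move=> xL yL; rewrite (_ : (fun t => _) = fun t => x t + (-1) *: y t).
  by apply: L2D => //; exact: L2Z.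
by apply/funext => t; rewrite scaleN1r.
Qed.

Lemma L2_cst (v : 'rV[R]_q) : L2 pi (cst v).
Proof.
apply/L2P; split; first by move=> j; exact: measurable_cst.
exact: (@finite_measure_integrable_cst _ _ _ pi setT (dot v v)).
Qed.

Lemma sqr_norm_pi x : norm_pi pi x ^+ 2 = inner pi x x.
Proof. by rewrite sqr_sqrtr// Rintegral_ge0// => t _; exact: dot_ge0. Qed.

End L2_theory.

(** * Measurable mean value points *)

Section bisection.
Context {R : realType}.
Implicit Type phi : R -> R.

Let wd n : R := 2^-1 ^+ n.

(** Left endpoint of the [n]-th of a nested sequence of dyadic intervals in [0, 1], of length
    [2^-n]: each step keeps the half on which [phi] increases less, the left one in case of a
    tie. *)
Fixpoint bisect phi n : R :=
  if n is n'.+1 then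
    let a := bisect phi n' in
    if phi (a + 2^-1 ^+ n) - phi a <=
         phi (a + 2^-1 ^+ n') - phi (a + 2^-1 ^+ n)
    then a else a + 2^-1 ^+ n
  else 0.

Definition bisect_lim phi : R := limn (bisect phi).

Let wd_gt0 n : 0 < wd n. Proof. by rewrite exprn_gt0. Qed.

Let wdS n : wd n = 2 * wd n.+1.
Proof. by rewrite /wd exprS mulrA divff ?mul1r. Qed.

Lemma bisect_step phi n :
  bisect phi n <= bisect phi n.+1 /\
  bisect phi n.+1 + 2^-1 ^+ n.+1 <= bisect phi n + 2^-1 ^+ n.
Proof.
have := wdS n; have := wd_gt0 n.+1; rewrite /wd => w0 ->.
by rewrite /=; case: ifP => _; split; lra.
Qed.

(** The two halves share the increment of [phi], so the half that is kept carries at most half of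
    it; the slope over the nested intervals thus never exceeds [phi 1 - phi 0]. *)
Lemma bisect_slope phi n :
  phi (bisect phi n + 2^-1 ^+ n) - phi (bisect phi n) <=
  (phi 1 - phi 0) * 2^-1 ^+ n.
Proof.
elim: n => [|n IH]; first by rewrite /= add0r expr0 mulr1.
have E : bisect phi n + 2^-1 ^+ n.+1 + 2^-1 ^+ n.+1 = bisect phi n + 2^-1 ^+ n.
  by have := wdS n; rewrite /wd => ->; ring.
have M : (phi 1 - phi 0) * 2^-1 ^+ n = 2 * ((phi 1 - phi 0) * 2^-1 ^+ n.+1).
  by have := wdS n; rewrite /wd => ->; ring.
move: IH; rewrite M.
rewrite [bisect phi n.+1]/=.
case: ifP => [|/negbT]; first lra.
by rewrite -ltNge E; lra.
Qed.

Lemma bisect_nd phi : nondecreasing_seq (bisect phi).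
Proof. by apply/nondecreasing_seqP => n; case: (bisect_step phi n). Qed.

Lemma bisect_le phi n k : (n <= k)%N ->
  bisect phi k <= bisect phi n + 2^-1 ^+ n.
Proof.
have H : nonincreasing_seq (fun n => bisect phi n + 2^-1 ^+ n).
  by apply/nonincreasing_seqP => i; case: (bisect_step phi i).
by move=> /H; apply: le_trans; rewrite lerDl ltW ?wd_gt0.
Qed.

Lemma bisect_cvg phi : bisect phi @ \oo --> bisect_lim phi.
Proof.
apply: nondecreasing_is_cvgn; first exact: bisect_nd.
by exists (bisect phi 0 + 2^-1 ^+ 0) => _ [n _ <-]; exact: bisect_le.
Qed.

Lemma bisect_lim_ge phi n : bisect phi n <= bisect_lim phi.
Proof.
by apply: nondecreasing_cvgn_le; [exact: bisect_nd | exact: bisect_cvg].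
Qed.

Lemma bisect_lim_le phi n : bisect_lim phi <= bisect phi n + 2^-1 ^+ n.
Proof.
apply: limr_le; first exact: bisect_cvg.
by near=> k; apply: bisect_le; near: k; exists n.
Unshelve. all: by end_near. Qed.

Lemma bisect_itv phi n : 0 <= bisect phi n /\ bisect phi n + 2^-1 ^+ n <= 1.
Proof.
elim: n => [|n [a0 a1]]; first by rewrite /= add0r expr0.
have [] := bisect_step phi n; split; lra.
Qed.

Lemma bisect_lim_itv phi : 0 <= bisect_lim phi <= 1.
Proof.
have := bisect_lim_ge phi 0; have := bisect_lim_le phi 0.
by rewrite /= add0r expr0 => -> ->.
Qed.

(** Multiplied out, the derivative estimate also covers [r = s], which matters when the limit of the
    bisection is an endpoint of one of its intervals. *)
Lemma is_derive_dist phi (s l : R) : is_derive s 1 phi l ->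
  forall e, 0 < e -> exists2 dl, 0 < dl &
    forall r, `|r - s| < dl -> `|phi r - phi s - l * (r - s)| <= e * `|r - s|.
Proof.
move=> [dphi dl] e e0.
have : h^-1 *: ((phi \o shift s) (h *: 1) - phi s) @[h --> 0^'] --> l.
  by rewrite -dl; exact: dphi.
move=> /cvgrPdist_le /(_ _ e0).
move=> /nbhs_ballP[dlt /= dlt0 H].
exists dlt => // r rs.
have [->|rs0] := eqVneq r s; first by rewrite !subrr mulr0 subr0 normr0 mulr0.
have rs1 : r - s != 0 by rewrite subr_eq0.
have := H (r - s); rewrite /ball /= sub0r normrN => /(_ rs rs1).
rewrite [(r - s) *: 1]mulr1 subrK [_ *: _](mulrC _ _) => {}H.
rewrite (_ : phi r - phi s - l * (r - s) =
  - ((l - (phi r - phi s) / (r - s)) * (r - s))); last first.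
  by field.
by rewrite normrN normrM ler_wpM2r.
Qed.

(** A one-sided mean value theorem: the limit lies in every nested interval, so its derivative is
    the limit of slopes that are all at most [phi 1 - phi 0]. *)
Lemma bisect_lim_derive_le phi l : is_derive (bisect_lim phi) 1 phi l ->
  l <= phi 1 - phi 0.
Proof.
move=> /is_derive_dist H; rewrite leNgt; apply/negP => lt.
set s := bisect_lim phi in H.
(* The tolerance is half the assumed gap. As [s] lies between [a] and [a + wd n], the errors at the
   two ends add up to at most this tolerance times [wd n], so the slope would stay above
   [phi 1 - phi 0]. *)
have e0 : 0 < (l - (phi 1 - phi 0)) / 2 by rewrite divr_gt0// subr_gt0.
have [dl dl0 {}H] := H _ e0.
have [n wn] : exists n, wd n < dl.
  have : wd @ \oo --> (0 : R).
    by apply: cvg_expr; rewrite ger0_norm// invf_lt1// ltr1n.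
  move=> /cvgrPdist_lt /(_ _ dl0) [n _ /(_ n (leqnn n))] /=.
  by rewrite sub0r normrN gtr0_norm ?wd_gt0// => ?; exists n.
have := bisect_slope phi n.
have := bisect_lim_ge phi n; have := bisect_lim_le phi n.
rewrite -/s -/(wd n); set a := bisect phi n => sa as_.
have : `|a - s| < dl by rewrite ler0_norm; lra.
have : `|(a + wd n) - s| < dl by rewrite ger0_norm; lra.
move=> /H + /H.
rewrite (ler0_norm (_ : a - s <= 0)); last lra.
rewrite (ger0_norm (_ : 0 <= (a + wd n) - s)); last lra.
rewrite !ler_norml => /andP[H1 _] /andP[_ H2].
set c := phi 1 - phi 0 in lt e0 H1 H2 *.
have := wd_gt0 n; have := mulr_gt0 e0 (wd_gt0 n).
move: H1 H2; lra.
Qed.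

(** Each bisection step is a measurable case distinction, and measurability passes to the pointwise
    limit. The hypothesis concerns only measurable choices of points in [0, 1], since measurability
    of the objective is known only along functions in [L2]. *)
Lemma measurable_bisect_lim {d : measure_display} {T : measurableType d}
    (psi : T -> R -> R) :
  (forall a : T -> R, measurable_fun setT a -> (forall t, 0 <= a t <= 1) ->
     measurable_fun setT (fun t => psi t (a t))) ->
  measurable_fun setT (fun t => bisect_lim (psi t)).
Proof.
move=> mpsi.
apply: (@measurable_fun_cvg _ _ _ _ (fun n t => bisect (psi t) n)); last first.
  by move=> t _; exact: bisect_cvg.
elim=> [|n IH] /=; first exact: measurable_cst.
have mD k : measurable_fun setT (fun t => bisect (psi t) n + 2^-1 ^+ k).
  by apply: measurable_funD => //; exact: measurable_cst.
have b01 t : 0 <= bisect (psi t) n <= 1.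
  have [-> h] := bisect_itv (psi t) n.
  by rewrite /= (le_trans _ h)// lerDl ltW// wd_gt0.
have b01' k t : (n <= k)%N -> 0 <= bisect (psi t) n + 2^-1 ^+ k <= 1.
  move=> nk; have [h1 h2] := bisect_itv (psi t) n.
  rewrite addr_ge0 ?exprn_ge0//= (le_trans _ h2)// lerD2l.
  by rewrite ler_wiXn2l// invf_le1// ler1n.
apply: measurable_fun_ifT => //.
apply: measurable_fun_ler; apply: measurable_funB; apply: mpsi => // t; exact: b01'.
Qed.

End bisection.

(** * Cocoercivity of the gradient *)

Section quadratic_bound.
Context {d : measure_display} {T : measurableType d} {R : realType} {q : nat}.
Variables (pi : probability T R) (f : 'rV[R]_q -> T -> R).
Implicit Types x h : T -> 'rV[R]_q.

Hypothesis f_diff : forall t y, differentiable (f ^~ t) y.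

Lemma derive_dot_grad (t : T) (y v : 'rV[R]_q) : 'D_v (f ^~ t) y = dot (grad f y t) v.
Proof.
rewrite deriveE// [in LHS](row_sum_delta v) linear_sum /dot.
by apply: eq_bigr => j _; rewrite linearZ mxE deriveE//= [_ *: _]mulrC.
Qed.

Lemma is_derive_segment (t : T) (y v : 'rV[R]_q) (s : R) :
  is_derive s 1 (fun r => f (y + r *: v) t) (dot (grad f (y + s *: v) t) v).
Proof.
(* The difference quotient along the segment is the directional quotient of [f] at [y + s *: v]. *)
have E : (fun h : R => h^-1 *: (((fun r => f (y + r *: v) t) \o shift s) (h *: 1)
      - f (y + s *: v) t)) =
    (fun h : R => h^-1 *: (((f ^~ t) \o shift (y + s *: v)) (h *: v)
      - f (y + s *: v) t)).
  apply/funext => h /=; congr (_ *: (f _ t - _)).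
  by rewrite [h *: 1]mulr1 scalerDl addrCA.
split.
  rewrite /derivable E.
  have := @diff_derivable _ _ _ (f ^~ t) _ v (f_diff t (y + s *: v)).
  by [].
by rewrite -derive_dot_grad /derive E.
Qed.

Hypothesis f_meas : forall x, L2 pi x -> measurable_fun setT (fun t => f (x t) t).

(* The mean value point is found by bisection so that it depends measurably on
   the parameter; the monotonicity hypothesis applies to such points only. *)
Lemma ae_quadratic_lower_bound (c : R) :
  (forall x1 x2, L2 pi x1 -> L2 pi x2 ->
    {ae pi, forall t, c * dot (x1 t - x2 t) (x1 t - x2 t) <=
      dot (grad_at f x1 t - grad_at f x2 t) (x1 t - x2 t)}) ->
  forall x h, L2 pi x -> L2 pi h ->
    {ae pi, forall t, dot (grad_at f x t) (h t) + c / 2 * dot (h t) (h t) <=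
      f (x t + h t) t - f (x t) t}.
Proof.
move=> mono x h xL hL.
(* Subtracting the quadratic makes the increment [psi t 1 - psi t 0] equal to the right-hand side
   minus [c / 2 |h|^2], while the derivative at [r] loses [c r |h|^2], the amount that monotonicity
   returns. *)
pose psi t r := f (x t + r *: h t) t + (- (c / 2 * dot (h t) (h t))) * r ^+ 2.
pose xi t := bisect_lim (psi t).
have mdot : measurable_fun setT (fun t => dot (h t) (h t)).
  by case: hL => mh _; exact: measurable_dot.
have mxi : measurable_fun setT xi.
  apply: measurable_bisect_lim => a ma a01; apply: measurable_funD.
    by apply: f_meas; exact: L2_segment.
  apply: measurable_funM; last exact: measurable_funX.
  apply: measurable_funN; apply: measurable_funM => //; exact: measurable_cst.
have xi01 t : 0 <= xi t <= 1 by exact: bisect_lim_itv.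
have dpsi t (s : R) : is_derive s 1 (psi t)
    (dot (grad f (x t + s *: h t) t) (h t) - c * s * dot (h t) (h t)).
  have := is_derive_segment t (x t) (h t) s => D1.
  apply: is_derive_eq.
  rewrite /GRing.scale /= !mulr1. lra.
have := mono _ _ (L2_segment xL hL mxi xi01) xL.
apply: filterS => t; rewrite /grad_at addrAC subrr add0r !dotE => mt.
have := bisect_lim_derive_le (dpsi t (bisect_lim (psi t))).
rewrite -/(xi t) /psi scale1r scale0r addr0 expr1n expr0n/= mulr1 mulr0 addr0.
have /andP[x0 _] := xi01 t.
(* Monotonicity between [x + xi h] and [x] carries a factor [xi t], which has to be divided out; at
   [xi t = 0] the derivative is already the gradient at [x]. *)
have [xi0|xi0] := eqVneq (xi t) 0.
  by rewrite xi0 scale0r addr0 mulr0 mul0r subr0; lra.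
have {}x0 : 0 < xi t by rewrite lt_neqAle eq_sym xi0.
set G := grad f (x t + _) t in mt *; set H := dot (h t) (h t) in mt *.
suff : c * xi t * H <= dot G (h t) - dot (grad f (x t) t) (h t) by lra.
rewrite -(ler_pM2l x0); move: mt; lra.
Qed.

End quadratic_bound.

Section cocoercivity.
Context {d : measure_display} {T : measurableType d} {R : realType} {q : nat}.
Variables (pi : probability T R) (f : 'rV[R]_q -> T -> R).
Implicit Types x y h : T -> 'rV[R]_q.

Local Notation integ f := (pi.-integrable setT (EFin \o f)).

Hypothesis f_gradL2 : forall x, L2 pi x -> L2 pi (grad_at f x).

Lemma glue_indic (A : set T) x1 x2 t :
  x2 t + \1_A t *: (x1 t - x2 t) = if t \in A then x1 t else x2 t.
Proof.
rewrite indicE; case: (t \in A); first by rewrite scale1r addrC subrK.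
by rewrite scale0r addr0.
Qed.

Lemma L2_glue (A : set T) x1 x2 : measurable A -> L2 pi x1 -> L2 pi x2 ->
  L2 pi (fun t => x2 t + \1_A t *: (x1 t - x2 t)).
Proof.
move=> mA x1L x2L; apply: L2_segment => //; first exact: L2B.
by move=> t; rewrite indicE; case: (_ \in _); rewrite ?lexx ?ler01.
Qed.

(** Apply the hypothesis to [x2] and the function equal to [x1] on [A] and to [x2] elsewhere: both
    differences vanish off [A], so the inequality holds integrated over every measurable [A]. *)
Lemma ae_strongly_convex (mu : R) : strongly_convex pi f mu ->
  forall x1 x2, L2 pi x1 -> L2 pi x2 ->
    {ae pi, forall t, mu * dot (x1 t - x2 t) (x1 t - x2 t) <=
      dot (grad_at f x1 t - grad_at f x2 t) (x1 t - x2 t)}.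
Proof.
move=> sc x1 x2 x1L x2L.
have hL := L2B x1L x2L; have DL := L2B (f_gradL2 x1L) (f_gradL2 x2L).
have i1 := L2_dot_integrable DL hL; have i2 := L2_dot_integrable hL hL.
have := integB i1 (integZl mu i2).
move/ae_ge0_of_Rint_indic => /(_ _)/wrap[A mA|]; last first.
  by apply: filterS => t; rewrite subr_ge0.
have xAL := L2_glue mA x1L x2L.
set xA := (fun t => _) in xAL.
have := sc _ _ xAL x2L; rewrite sqr_norm_pi /inner.
have iA g : integ g -> integ (fun t => \1_A t * g t) by exact: integ_indic_mul.
have -> : \int[pi]_t dot ((xA \- x2) t) ((xA \- x2) t) =
    \int[pi]_t (\1_A t * dot (x1 t - x2 t) (x1 t - x2 t)).
  apply: eq_Rintegral => t _; rewrite /xA /= glue_indic indicE.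
  by case: (t \in A); rewrite ?mul1r// subrr dot0l mul0r.
have -> : \int[pi]_t dot ((grad_at f xA \- grad_at f x2) t) ((xA \- x2) t) =
    \int[pi]_t (\1_A t * dot (grad_at f x1 t - grad_at f x2 t) (x1 t - x2 t)).
  apply: eq_Rintegral => t _; rewrite /xA /grad_at /= glue_indic indicE.
  by case: (t \in A); rewrite ?mul1r// !subrr dot0l mul0r.
rewrite -subr_ge0 -RintegralZl ?iA// -RintegralB ?iA//; last exact/integZl/iA.
by under eq_Rintegral do rewrite (mulrCA mu) -mulrBr.
Qed.

(** The same gluing, after squaring the norm inequality so that both sides become integrals. *)
Lemma ae_lipschitz_gradient (L : R) : lipschitz_gradient pi f L ->
  forall x1 x2, L2 pi x1 -> L2 pi x2 ->
    {ae pi, forall t,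
      dot (grad_at f x1 t - grad_at f x2 t) (grad_at f x1 t - grad_at f x2 t) <=
      L ^+ 2 * dot (x1 t - x2 t) (x1 t - x2 t)}.
Proof.
move=> lip x1 x2 x1L x2L.
have hL := L2B x1L x2L; have DL := L2B (f_gradL2 x1L) (f_gradL2 x2L).
have i1 := L2_dot_integrable DL DL; have i2 := L2_dot_integrable hL hL.
have := integB (integZl (L ^+ 2) i2) i1.
move/ae_ge0_of_Rint_indic => /(_ _)/wrap[A mA|]; last first.
  by apply: filterS => t; rewrite subr_ge0.
have xAL := L2_glue mA x1L x2L.
set xA := (fun t => _) in xAL.
have := lip _ _ xAL x2L.
have N0 (y : T -> 'rV[R]_q) : 0 <= norm_pi pi y by exact: sqrtr_ge0.
move=> H; have : norm_pi pi (grad_at f xA \- grad_at f x2) ^+ 2 <=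
    (L * norm_pi pi (xA \- x2)) ^+ 2.
  by rewrite lerXn2r// nnegrE// (le_trans _ H).
rewrite exprMn !sqr_norm_pi /inner.
have iA g : integ g -> integ (fun t => \1_A t * g t) by exact: integ_indic_mul.
have -> : \int[pi]_t dot ((xA \- x2) t) ((xA \- x2) t) =
    \int[pi]_t (\1_A t * dot (x1 t - x2 t) (x1 t - x2 t)).
  apply: eq_Rintegral => t _; rewrite /xA /= glue_indic indicE.
  by case: (t \in A); rewrite ?mul1r// subrr dot0l mul0r.
have -> : \int[pi]_t dot ((grad_at f xA \- grad_at f x2) t)
      ((grad_at f xA \- grad_at f x2) t) =
    \int[pi]_t (\1_A t * dot (grad_at f x1 t - grad_at f x2 t)
      (grad_at f x1 t - grad_at f x2 t)).
  apply: eq_Rintegral => t _; rewrite /xA /grad_at /= glue_indic indicE.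
  by case: (t \in A); rewrite ?mul1r// !subrr dot0l mul0r.
rewrite -subr_ge0 -RintegralZl ?iA// -RintegralB ?iA//; last exact/integZl/iA.
by under eq_Rintegral do rewrite (mulrCA (L ^+ 2)) -mulrBr.
Qed.

Hypothesis f_diff : forall t (y : 'rV[R]_q), differentiable (f ^~ t) y.
Hypothesis f_meas : forall x, L2 pi x -> measurable_fun setT (fun t => f (x t) t).

Lemma grad_opp (y : 'rV[R]_q) (t : T) :
  grad (fun z s => - f z s) y t = - grad f y t.
Proof.
apply/rowP => j; rewrite !mxE.
rewrite -(@deriveN _ _ _ (f ^~ t))//; exact: diff_derivable.
Qed.

Variables (mu L : R).
Hypotheses (mu_gt0 : 0 < mu) (mu_le : mu <= L).
Hypotheses (f_sc : strongly_convex pi f mu) (f_lip : lipschitz_gradient pi f L).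

(** Expanding [|D - L h|^2 >= 0] gives [2 L <D, h> <= |D|^2 + L^2 |h|^2], and the Lipschitz bound
    makes the right-hand side at most [2 L^2 |h|^2]. *)
Lemma ae_gradient_upper_bound x1 x2 : L2 pi x1 -> L2 pi x2 ->
  {ae pi, forall t, dot (grad_at f x1 t - grad_at f x2 t) (x1 t - x2 t) <=
    L * dot (x1 t - x2 t) (x1 t - x2 t)}.
Proof.
move=> x1L x2L; have := ae_lipschitz_gradient f_lip x1L x2L.
apply: filterS => t.
set D := grad_at f x1 t - _; set h := x1 t - _; clearbody D h => DL.
have L0 : 0 < L by exact: lt_le_trans mu_le.
have := dot_ge0 (D - L *: h); rewrite !dotE (dotC h D) => H.
rewrite -(ler_pM2l L0); move: DL H; lra.
Qed.

Lemma ae_convex_lower_bound x h : L2 pi x -> L2 pi h ->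
  {ae pi, forall t, dot (grad_at f x t) (h t) + mu / 2 * dot (h t) (h t) <=
      f (x t + h t) t - f (x t) t}.
Proof.
by apply: ae_quadratic_lower_bound => //; exact: ae_strongly_convex.
Qed.

(** The quadratic lower bound for [- f] with the negative constant [- L]. *)
Lemma ae_smooth_upper_bound x h : L2 pi x -> L2 pi h ->
  {ae pi, forall t, f (x t + h t) t - f (x t) t <=
    dot (grad_at f x t) (h t) + L / 2 * dot (h t) (h t)}.
Proof.
move=> xL hL.
have := @ae_quadratic_lower_bound _ _ _ _ pi (fun z s => - f z s) _ _ (- L) _ _ _ xL hL.
move=> /(_ _ _ _)/wrap[t y|y yL|x1 x2 x1L x2L|].
- exact: (@differentiableN _ _ _ (f ^~ t)).
- by apply: measurable_funN; exact: f_meas.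
- have := ae_gradient_upper_bound x1L x2L; apply: filterS => t.
  by rewrite /grad_at !grad_opp -opprD dotNl mulNr lerN2.
- by apply: filterS => t; rewrite /grad_at !grad_opp dotNl; lra.
Qed.

(* The minimising step [x2 - (grad g x2 - grad g x1) / (L - mu)] of the quadratic
   upper bound of [g := f - mu / 2 * |.|^2] at [x2]. *)
Lemma ae_bregman_lower_bound x1 x2 : mu < L -> L2 pi x1 -> L2 pi x2 ->
  {ae pi, forall t,
    let k := x2 t - x1 t in
    let e := grad_at f x2 t - grad_at f x1 t - mu *: k in
    dot (grad_at f x1 t) k + mu / 2 * dot k k + (L - mu)^-1 / 2 * dot e e <=
    f (x2 t) t - f (x1 t) t}.
Proof.
move=> muL x1L x2L.
have kL := L2B x2L x1L.
pose e t := grad_at f x2 t - grad_at f x1 t - mu *: (x2 t - x1 t).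
have eL : L2 pi e by apply: L2B; [apply: L2B; exact: f_gradL2 | exact: L2Z].
have pL := L2Z (- (L - mu)^-1) eL.
(* With [p := - (L - mu)^-1 e], the displacement [k + p] from [x1] and the displacement [p] from
   [x2] reach the same point, so the value of [f] there cancels between the two bounds. *)
have := ae_convex_lower_bound x1L (L2D kL pL).
have := ae_smooth_upper_bound x2L pL.
apply: filterS2 => t; rewrite -/(e t) addrA (addrC (x1 t)) subrK.
set k := x2 t - x1 t; set z := x2 t + _.
set a := grad_at f x1 t; set M := L - mu.
have M0 : M != 0 by rewrite subr_eq0 gt_eqF.
have -> : grad_at f x2 t = a + (mu *: k + e t).
  by rewrite /e -/k -/a (addrC (mu *: k)) subrK addrC subrK.
move: (e t) => et; clearbody k a z.
rewrite !dotE (dotC k et).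
have MM : (M^-1 * M^-1) * dot et et * M = M^-1 * dot et et by field.
have -> : L = M + mu by rewrite /M subrK.
move: MM; set s := M^-1; lra.
Qed.

(** Adding the Bregman bounds for [(x1, x2)] and [(x2, x1)] cancels the values of [f] and leaves [mu
    |h|^2 + |D - mu h|^2 / (L - mu) <= <D, h>]; multiplying by [L - mu] gives the claim. *)
Lemma ae_cocoercive x1 x2 : L2 pi x1 -> L2 pi x2 ->
  {ae pi, forall t,
    let h := x1 t - x2 t in let D := grad_at f x1 t - grad_at f x2 t in
    dot D D + mu * L * dot h h <= (mu + L) * dot D h}.
Proof.
move=> x1L x2L.
move: (mu_le); rewrite le_eqVlt => /orP[/eqP muL|muL].
  have := ae_strongly_convex f_sc x1L x2L.
  have := ae_lipschitz_gradient f_lip x1L x2L.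
  apply: filterS2 => t /=; set h := x1 t - _; set D := _ - grad_at f x2 t.
  clearbody h D.
  rewrite -muL => h1; rewrite -(ler_pM2l mu_gt0) => h2.
  by move: h1 h2; lra.
have := ae_bregman_lower_bound muL x1L x2L.
have := ae_bregman_lower_bound muL x2L x1L.
apply: filterS2 => t /=.
set h := x1 t - x2 t; set a := grad_at f x1 t; set b := grad_at f x2 t.
rewrite -(opprB (x1 t)) -/h -(opprB a b); set D := a - b.
have -> : a = b + D by rewrite /D addrC subrK.
clearbody h D b; set M := L - mu.
have M0 : 0 < M by rewrite subr_gt0.
rewrite !dotE (dotC h D) => H1 H2.
(* [H1] and [H2] contain the factor [M^-1]; multiplying the goal by it makes the goal linear in the
   same products. *)
rewrite -subr_ge0 -(pmulr_rge0 _ (_ : 0 < M^-1)) ?invr_gt0//.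
have E1 : M^-1 * M = 1 by rewrite mulVf// gt_eqF.
have E : L = M + mu by rewrite /M subrK.
have -> : M^-1 * ((mu + L) * dot D h - (dot D D + mu * L * dot h h)) =
  (M^-1 * M) * dot D h - (M^-1 * M) * mu * dot h h
  - M^-1 * (dot D D - 2 * mu * dot D h + mu ^+ 2 * dot h h).
  by rewrite E; ring.
rewrite E1; move: H1 H2; lra.
Qed.

Lemma cocoercive x1 x2 : L2 pi x1 -> L2 pi x2 ->
  norm_pi pi (grad_at f x1 \- grad_at f x2) ^+ 2
    + mu * L * norm_pi pi (x1 \- x2) ^+ 2 <=
  (mu + L) * inner pi (grad_at f x1 \- grad_at f x2) (x1 \- x2).
Proof.
move=> x1L x2L.
have hL := L2B x1L x2L; have DL := L2B (f_gradL2 x1L) (f_gradL2 x2L).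
have iDD := L2_dot_integrable DL DL; have iDh := L2_dot_integrable DL hL.
have ihh := L2_dot_integrable hL hL.
rewrite !sqr_norm_pi /inner /=.
rewrite -!RintegralZl// -RintegralD//; last exact: integZl.
apply: ae_le_Rint.
- by apply: integD => //; exact: integZl.
- exact: integZl.
- exact: ae_cocoercive.
Qed.

End cocoercivity.

(** Compare two constant functions, the all-ones vector (nonzero as [q >= 1]) and zero. Then
    [2 mu <D, h> <= |D|^2 + mu^2 |h|^2] combined with the two hypotheses yields [mu^2 <= L^2]. *)
Lemma strongly_convex_lipschitz_le {d : measure_display} {T : measurableType d}
    {R : realType} {q : nat} (pi : probability T R) (f : 'rV[R]_q -> T -> R)
    (mu L : R) : (1 <= q)%N ->
  (forall x, L2 pi x -> L2 pi (grad_at f x)) -> 0 < mu ->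
  strongly_convex pi f mu -> lipschitz_gradient pi f L -> mu <= L.
Proof.
case: q f => // q f _ fL2 mu0 sc lip.
pose v : 'rV[R]_q.+1 := \row_j 1.
have v0 : 0 < dot v v.
  rewrite /dot big_ord_recl ltr_pwDl// ?mxE ?mulr1// sumr_ge0// => j _.
  by rewrite !mxE mulr1.
have c1 := L2_cst pi v; have c0 := L2_cst pi (0 : 'rV[R]_q.+1).
have Ih : inner pi (cst v \- cst 0) (cst v \- cst 0) = dot v v.
  transitivity (\int[pi]_(t in setT) dot v v).
    by apply: eq_Rintegral => t _ /=; rewrite subr0.
  by rewrite Rintegral_cst// [X in fine X]probability_setT mulr1.
have N0 (y : T -> 'rV[R]_q.+1) : 0 <= norm_pi pi y by exact: sqrtr_ge0.
have Nh : 0 < norm_pi pi (cst v \- cst 0) by rewrite sqrtr_gt0 Ih.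
have L0 : 0 <= L.
  have := lip _ _ c1 c0 => /(le_trans (N0 _)).
  by rewrite pmulr_lge0.
have := sc _ _ c1 c0; rewrite sqr_norm_pi Ih => H1.
have := lip _ _ c1 c0 => H.
have {H} : norm_pi pi (grad_at f (cst v) \- grad_at f (cst 0)) ^+ 2 <=
    (L * norm_pi pi (cst v \- cst 0)) ^+ 2.
  by rewrite lerXn2r// nnegrE// (le_trans _ H).
rewrite exprMn !sqr_norm_pi Ih => H2.
have hL := L2B c1 c0; have DL := L2B (fL2 _ c1) (fL2 _ c0).
have iDD := L2_dot_integrable DL DL; have iDh := L2_dot_integrable DL hL.
have ihh := L2_dot_integrable hL hL.
have : 2 * mu * inner pi (grad_at f (cst v) \- grad_at f (cst 0)) (cst v \- cst 0)
    <= inner pi (grad_at f (cst v) \- grad_at f (cst 0))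
             (grad_at f (cst v) \- grad_at f (cst 0)) + mu ^+ 2 * dot v v.
  rewrite -Ih /inner /= -!RintegralZl// -RintegralD//; last exact: integZl.
  apply: le_Rintegral => //; [exact: integZl| |].
    by apply: integD => //; exact: integZl.
  move=> t _; set D := _ - grad_at _ _ t; set h := _ - cst 0 t.
  clearbody D h.
  by have := dot_ge0 (D - mu *: h); rewrite !dotE (dotC h D); lra.
move: H2; rewrite -[_ <= L]ler_sqr ?nnegrE ?(ltW mu0)// -(ler_pM2r v0) => H2 H3.
by have := ler_wpM2l (ltW mu0) H1; move: H2 H3; lra.
Qed.

(** * Coefficients in the basis *)

Section Lfun2.
Context {d : measure_display} {T : measurableType d} {R : realType}.
Variable mu : {measure set T -> \bar R}.
Implicit Types h g : T -> R.

Local Notation integ f := (mu.-integrable setT (EFin \o f)).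

Lemma integrable_sqr_Lfun2 h : measurable_fun setT h ->
  integ (fun t => h t ^+ 2) -> h \in Lfun mu 2%:E.
Proof.
move=> mh /integrableP[_ hi]; rewrite inE; apply/andP; split; rewrite inE//=.
rewrite /finite_norm unlock; apply: poweR_lty; apply: le_lt_trans hi.
rewrite le_eqVlt; apply/orP; left; apply/eqP/eq_integral => t _ /=.
by rewrite normrX powR_mulrn.
Qed.

Lemma Lfun2_mul_integrable h g : h \in Lfun mu 2%:E -> g \in Lfun mu 2%:E ->
  integ (fun t => h t * g t).
Proof. by move=> hL gL; apply/Lfun1_integrable; exact: Lfun2_mul_Lfun1. Qed.

Lemma Lfun2_scaleD (a : R) h g : h \in Lfun mu 2%:E -> g \in Lfun mu 2%:E ->
  (fun t => a * h t + g t) \in Lfun mu 2%:E.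
Proof.
have [_ H] := Lfun_submod_closed mu (lee1n 2).
exact: H.
Qed.

Lemma Lfun2_lin (n : nat) h (a : nat -> R) (b : nat -> T -> R) :
  h \in Lfun mu 2%:E -> (forall i, b i \in Lfun mu 2%:E) ->
  (fun t => h t - \sum_(i < n) a i * b i t) \in Lfun mu 2%:E.
Proof.
move=> hL bL; elim: n => [|n IH].
  by rewrite (_ : (fun t => _) = h)//; apply/funext => t; rewrite big_ord0 subr0.
rewrite (_ : (fun t => _) =
    (fun t => - a n * b n t + (h t - \sum_(i < n) a i * b i t))).
  exact: Lfun2_scaleD.
by apply/funext => t; rewrite big_ord_recr/=; ring.
Qed.

End Lfun2.

Section coefficients.
Context {d : measure_display} {T : measurableType d} {R : realType} {q : nat}.
Variables (pi : probability T R) (B : nat -> T -> R).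
Hypothesis B_basis : orthonormal_basis pi B.
Implicit Types x y h : T -> 'rV[R]_q.

Local Notation integ f := (pi.-integrable setT (EFin \o f)).

Let BL i : B i \in Lfun pi 2%:E. Proof. by case: B_basis. Qed.

(* The remainder in the completeness property is constant from [n = m] on. *)
Lemma ae_finite_expansion (phi : T -> R) m : phi \in Lfun pi 2%:E ->
  (forall i, (m <= i)%N -> \int[pi]_t (phi t * B i t) = 0) ->
  {ae pi, forall t, phi t = \sum_(i < m) (\int[pi]_s (phi s * B i s)) * B i t}.
Proof.
move=> phiL c0; case: B_basis => _ _ /(_ _ phiL).
set c := fun i => \int[pi]_s (phi s * B i s).
set I := fun n : nat => _; move=> Icvg.
have Ist n : (m <= n)%N -> I n = I m.
  move=> mn; apply: eq_Rintegral => t _; congr ((_ - _) ^+ 2).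
  rewrite -(subnKC mn) big_split_ord/= [X in _ + X]big1 ?addr0// => i _.
  by rewrite c0 ?mul0r//= leq_addr.
have Im0 : I m = 0.
  have H : I @ \oo --> I m.
    by apply: cvg_near_cst; exists m => // n; exact: Ist.
  exact: (cvg_unique (@norm_hausdorff _ _) H Icvg).
have L := Lfun2_lin m c phiL BL.
have := Rint_eq0_ae (Lfun2_integrable_sqr L) (fun t => sqr_ge0 _) Im0.
by apply: filterS => t /= /eqP; rewrite sqrf_eq0 subr_eq0 => /eqP.
Qed.

(** Parseval's identity, by substituting the finite expansion of [phi]; [psi] may have infinitely
    many nonzero coefficients, as a gradient does. *)
Lemma Rint_finite_expansion (phi psi : T -> R) m :
  phi \in Lfun pi 2%:E -> psi \in Lfun pi 2%:E ->
  (forall i, (m <= i)%N -> \int[pi]_t (phi t * B i t) = 0) ->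
  \int[pi]_t (phi t * psi t) =
  \sum_(i < m) (\int[pi]_t (phi t * B i t)) * (\int[pi]_t (psi t * B i t)).
Proof.
move=> phiL psiL c0.
have iB i : integ (fun t => psi t * B i t) by exact: Lfun2_mul_integrable.
have iZ (i : 'I_m) := integZl (\int[pi]_s (phi s * B i s)) (iB i).
rewrite (@ae_eq_Rint _ _ _ _ _
  (fun t => \sum_(i < m) (\int[pi]_s (phi s * B i s)) * (psi t * B i t))).
- by rewrite Rint_sum//; apply: eq_bigr => i _; rewrite RintegralZl.
- exact: Lfun2_mul_integrable.
- exact: integ_sum.
- have := ae_finite_expansion phiL c0; apply: filterS => t {1}->.
  by rewrite mulr_suml; apply: eq_bigr => i _; rewrite mulrAC mulrA.
Qed.

(** Bessel's inequality for one basis function: expand the squared distance of [phi] to its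
    projection. *)
Lemma bessel1 (phi : T -> R) i : phi \in Lfun pi 2%:E ->
  (\int[pi]_t (phi t * B i t)) ^+ 2 <= \int[pi]_t (phi t ^+ 2).
Proof.
move=> phiL; set c := \int[pi]_t _.
have i1 := Lfun2_integrable_sqr phiL.
have i2 : integ (fun t => phi t * B i t) by exact: Lfun2_mul_integrable.
have i3 : integ (fun t => B i t * B i t) by exact: Lfun2_mul_integrable.
have B1 : \int[pi]_t (B i t * B i t) = 1 by case: B_basis => _ -> _; rewrite eqxx.
have : 0 <= \int[pi]_t ((phi t - c * B i t) ^+ 2).
  by apply: Rintegral_ge0 => t _; exact: sqr_ge0.
have -> : \int[pi]_t ((phi t - c * B i t) ^+ 2) = \int[pi]_t
    ((phi t ^+ 2 + (- (2 * c)) * (phi t * B i t)) + c ^+ 2 * (B i t * B i t)).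
  by apply: eq_Rintegral => t _; ring.
rewrite RintegralD//; [|by apply: integD => //; exact: integZl|exact: integZl].
rewrite RintegralD//; last exact: integZl.
by rewrite !RintegralZl// B1 -/c; lra.
Qed.

Lemma L2_coord_Lfun2 x j : L2 pi x -> (fun t => x t 0 j) \in Lfun pi 2%:E.
Proof.
move=> /L2P[mx xi]; apply: integrable_sqr_Lfun2 => //.
apply: (integ_le _ xi); first exact: measurable_funX.
by move=> t; rewrite ger0_norm ?sqr_ge0// sqr_coord_le_dot.
Qed.

Lemma coefB x y i : L2 pi x -> L2 pi y ->
  coef pi B (x \- y) i = coef pi B x i - coef pi B y i.
Proof.
move=> xL yL; apply/rowP => j; rewrite !mxE -RintegralB//;
  try by apply: Lfun2_mul_integrable => //; exact: L2_coord_Lfun2.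
by apply: eq_Rintegral => t _; rewrite !mxE mulrBl.
Qed.

(** A function of level [m] sees only the first [m] coefficients of [y], which is why the truncated
    gradient can stand in for the full one. *)
Lemma inner_finite_coef x y m : L2 pi x -> L2 pi y ->
  (forall i, (m <= i)%N -> coef pi B x i = 0) ->
  inner pi x y = \sum_(i < m) dot (coef pi B x i) (coef pi B y i).
Proof.
move=> xL yL x0; rewrite /inner /dot Rint_sum; last first.
  by move=> j; apply: Lfun2_mul_integrable; exact: L2_coord_Lfun2.
rewrite exchange_big; apply: eq_bigr => j _.
rewrite (@Rint_finite_expansion _ _ m); try exact: L2_coord_Lfun2.
  by apply: eq_bigr => i _; rewrite !mxE.
by move=> i /x0 /rowP /(_ j); rewrite !mxE.
Qed.

Lemma sqr_coef_le x i j : L2 pi x -> coef pi B x i 0 j ^+ 2 <= inner pi x x.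
Proof.
move=> xL; rewrite mxE (le_trans (bessel1 i (L2_coord_Lfun2 j xL)))//.
apply: le_Rintegral => //.
- exact/Lfun2_integrable_sqr/L2_coord_Lfun2.
- exact: L2_dot_integrable.
- by move=> t _; exact: sqr_coord_le_dot.
Qed.

End coefficients.

Lemma l2normsq_finite {R : realType} {q : nat} (v : nat -> 'rV[R]_q) m :
  (forall i, (m <= i)%N -> v i = 0) ->
  l2normsq v = (\sum_(i < m) dot (v i) (v i))%:E.
Proof.
move=> v0; rewrite /l2normsq (@nneseries_split _ _ 0 m); last first.
  by move=> i _; rewrite lee_fin dot_ge0.
rewrite add0n [X in (_ + X)%E]eseries0 ?adde0.
  by rewrite big_mkord sumEFin.
by move=> i mi _; rewrite v0// dot0l.
Qed.

(** * Conditional expectations *)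

Import HBNNSimple.

Section measurable_wrt_theory.
Context {d : measure_display} {W : measurableType d} {R : realType}.
Variable G : set (set W).
Hypothesis sG : sigma_algebra setT G.

(** Re-equipping [W] with the sigma-algebra [G] makes the general theory of measurable functions
    applicable. *)
Lemma measurable_wrtP {d'} {S : measurableType d'} (Y : W -> S) :
  measurable_wrt G Y <->
  measurable_fun setT (Y : g_sigma_algebraType G -> S).
Proof.
have mG : @measurable _ (g_sigma_algebraType G) = G by exact: sigma_algebra_id.
split=> [mY _ A mA|mY A mA].
  by rewrite setTI; apply: sub_sigma_algebra; exact: mY.
have := mY measurableT _ mA; by rewrite setTI [X in X _ -> _]mG.
Qed.

Lemma measurable_wrt_cst {d'} {S : measurableType d'} (s : S) :
  measurable_wrt G (fun=> s : S).
Proof. by apply/measurable_wrtP; exact: measurable_cst. Qed.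

Lemma measurable_wrt_step (Y Z : W -> R) (c : R) :
  measurable_wrt G Y -> measurable_wrt G Z ->
  measurable_wrt G (fun w => Y w - c * Z w).
Proof.
move=> /measurable_wrtP mY /measurable_wrtP mZ; apply/measurable_wrtP.
by apply: measurable_funB => //; apply: measurable_funM => //; exact: measurable_cst.
Qed.

End measurable_wrt_theory.

Lemma wrt_simple_approx {dW : measure_display} {W : measurableType dW}
    {R : realType} (G : set (set W)) (Z : W -> R) :
  sigma_algebra setT G -> measurable_wrt G Z -> (forall w, 0 <= Z w) ->
  exists h : nat -> W -> R,
    [/\ forall n, exists N (a : 'I_N -> R) (A : 'I_N -> set W),
          (forall i, G (A i)) /\ forall w, h n w = \sum_(i < N) a i * \1_(A i) w,
        forall n w, 0 <= h n w <= Z w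
      & forall w, h ^~ w @ \oo --> Z w].
Proof.
move=> sG mZ Z0.
have mG : @measurable _ (g_sigma_algebraType G) = G by exact: sigma_algebra_id.
pose Z' : g_sigma_algebraType G -> \bar R := EFin \o Z.
have mZ' : measurable_fun setT Z'.
  by apply/measurable_EFinP/(measurable_wrtP sG).
have Z0' t : setT t -> (0 <= Z' t)%E by rewrite lee_fin.
pose h := nnsfun_approx measurableT mZ'.
exists (fun n w => h n w); split.
(* The coefficients enumerate the finite range of [h n], and the sets are its fibres, which lie in
   [G]. *)
- move=> n; pose s : seq R := finmap.enum_fset (fset_set (h n @` setT)).
  exists (size s), (fun i => s`_i), (fun i => h n @^-1` [set s`_i]); split.
    move=> i; have : measurable (h n @^-1` [set s`_i]) by exact: measurable_sfunP.
    by rewrite [X in X _ -> _]mG.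
  by move=> w; rewrite [LHS]fimfunEord.
- move=> n w; apply/andP; split; first exact: fun_ge0.
  by rewrite -lee_fin /h nnsfun_approxE; exact: (le_approx n Z0').
- move=> w; have := @cvg_nnsfun_approx _ _ _ _ measurableT _ mZ' Z0' w I.
  by move/fine_cvg.
Qed.

(** * Pulling a measurable factor out of a conditional expectation *)

Section pull_out.
Context {d : measure_display} {W : measurableType d} {R : realType}.
Variables (P : probability W R) (G : set (set W)).
Hypotheses (sG : sigma_algebra setT G) (Gm : G `<=` measurable).
Implicit Types X Y Z : W -> R.

Local Notation integ f := (P.-integrable setT (EFin \o f)).

Lemma measurable_wrtW {d'} {S : measurableType d'} (Z : W -> S) :
  measurable_wrt G Z -> measurable_fun setT Z.
Proof. by move=> mZ _ A mA; rewrite setTI; exact/Gm/mZ. Qed.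

Lemma Rint_indic_mul (A : set W) X : \int[P]_w (\1_A w * X w) = \int[P]_(w in A) X w.
Proof.
rewrite [RHS]Rintegral_mkcond; apply: eq_Rintegral => w _.
by rewrite patchE indicE; case: (w \in A); rewrite ?mul1r ?mul0r.
Qed.

Lemma cond_exp_simple_mul X Y N (a : 'I_N -> R) (A : 'I_N -> set W) :
  is_cond_exp P G X Y -> (forall i, G (A i)) ->
  \int[P]_w ((\sum_(i < N) a i * \1_(A i) w) * X w) =
  \int[P]_w ((\sum_(i < N) a i * \1_(A i) w) * Y w).
Proof.
move=> [iX iY _ XY] GA.
have iA U i : integ U -> integ (fun w => \1_(A i) w * U w).
  by apply: integ_indic_mul; exact/Gm.
have E U : integ U -> \int[P]_w ((\sum_(i < N) a i * \1_(A i) w) * U w) =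
    \sum_(i < N) a i * \int[P]_(w in A i) U w.
  move=> iU; under eq_Rintegral do rewrite mulr_suml.
  rewrite Rint_sum => [|i]; last first.
    by apply: integ_eq (integZl (a i) (iA _ i iU)) => w; rewrite mulrA.
  apply: eq_bigr => i _; under eq_Rintegral do rewrite -mulrA.
  by rewrite RintegralZl ?iA// Rint_indic_mul.
by rewrite !E//; apply: eq_bigr => i _; rewrite XY.
Qed.

(** Dominated convergence with bound [|Z X|]. *)
Lemma dominated_Rint_mul (h : nat -> W -> R) X Z :
  (forall n, measurable_fun setT (h n)) -> measurable_fun setT X ->
  (forall n w, 0 <= h n w <= Z w) -> (forall w, h ^~ w @ \oo --> Z w) ->
  integ (fun w => Z w * X w) ->
  (fun n => \int[P]_w (h n w * X w)) @ \oo --> \int[P]_w (Z w * X w).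
Proof.
move=> mh mX hZ hcvg iZX.
apply: fine_cvg; rewrite fineK ?(integrable_fin_num _ iZX)//.
have [] := @dominated_convergence _ _ _ P setT measurableT
  (fun n w => (h n w * X w)%:E) (fun w => (Z w * X w)%:E)
  (fun w => `|Z w * X w|%:E).
- by move=> n; apply/measurable_EFinP; exact: measurable_funM.
- exact: measurable_int iZX.
- apply: aeW => w _; apply: cvg_EFin; first exact: nearW.
  by apply: cvgM; [exact: hcvg | exact: cvg_cst].
- exact: integrable_norm iZX.
- apply: aeW => w n _; rewrite lee_fin !normrM ler_wpM2r//.
  by have /andP[h0 h1] := hZ n w; rewrite !ger0_norm// (le_trans h0).
- by [].
Qed.

(** Both sides are limits of one sequence: for simple factors over [G] the two integrals agree. *)
Lemma cond_exp_mul_ge0 X Y Z : is_cond_exp P G X Y -> measurable_wrt G Z ->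
  (forall w, 0 <= Z w) ->
  integ (fun w => Z w * X w) -> integ (fun w => Z w * Y w) ->
  \int[P]_w (Z w * X w) = \int[P]_w (Z w * Y w).
Proof.
move=> XY mZ Z0 iZX iZY; have [iX iY _ _] := XY.
have [h [hs hZ hcvg]] := wrt_simple_approx sG mZ Z0.
have mh n : measurable_fun setT (h n).
  have [N [a [A [GA /funext ->]]]] := hs n.
  apply: measurable_sum => i; apply: measurable_funM; first exact: measurable_cst.
  exact/measurable_indic/Gm.
have cX := dominated_Rint_mul mh (integ_meas iX) hZ hcvg iZX.
have cY := dominated_Rint_mul mh (integ_meas iY) hZ hcvg iZY.
apply: (cvg_unique (@norm_hausdorff _ _) cX).
rewrite (_ : (fun n => _) = (fun n => \int[P]_w (h n w * Y w)))//.
apply/funext => n; have [N [a [A [GA /funext ->]]]] := hs n.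
exact: cond_exp_simple_mul.
Qed.

(** Split [Z] into its positive and negative parts; both are at most [|Z|] in absolute value, so
    integrability of the products is inherited. *)
Lemma cond_exp_mul X Y Z : is_cond_exp P G X Y -> measurable_wrt G Z ->
  integ (fun w => Z w * X w) -> integ (fun w => Z w * Y w) ->
  \int[P]_w (Z w * X w) = \int[P]_w (Z w * Y w).
Proof.
move=> XY mZ iZX iZY; have [iX iY _ _] := XY.
have mZW := measurable_wrtW mZ.
pose Zp w := Num.max (Z w) 0; pose Zn w := Num.max (- Z w) 0.
have wrt_comp (g : R -> R) : measurable_fun setT g -> measurable_wrt G (g \o Z).
  move=> mg A mA; rewrite comp_preimage; apply: mZ.
  by rewrite -[_ @^-1` _]setTI; exact: mg.
have mp : measurable_wrt G Zp.
  apply: (wrt_comp (fun r => Num.max r 0)); apply: measurable_maxr => //.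
have mn : measurable_wrt G Zn.
  apply: (wrt_comp (fun r => Num.max (- r) 0)); apply: measurable_maxr => //.
have iM (V U : W -> R) : integ U -> measurable_wrt G V ->
    (forall w, `|V w| <= `|Z w|) ->
    integ (fun w => Z w * U w) -> integ (fun w => V w * U w).
  move=> iU mV VZ iZU; apply: (integ_le _ (integrable_norm iZU)).
    apply: measurable_funM; [exact: measurable_wrtW | exact: integ_meas iU].
  by move=> w /=; rewrite !normrM ler_wpM2r.
have ZpZ w : `|Zp w| <= `|Z w|.
  by rewrite /Zp; case: (leP (Z w) 0); rewrite ?normr0.
have ZnZ w : `|Zn w| <= `|Z w|.
  by rewrite /Zn; case: (leP (- Z w) 0); rewrite ?normr0 ?normrN.
have E (U : W -> R) : integ U -> integ (fun w => Z w * U w) -> \int[P]_w (Z w * U w) =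
    \int[P]_w (Zp w * U w) - \int[P]_w (Zn w * U w).
  move=> iU iZU; rewrite -RintegralB; [|by []|exact: iM iU mp ZpZ iZU|
    exact: iM iU mn ZnZ iZU].
  apply: eq_Rintegral => w _; rewrite -mulrBl; congr (_ * _).
  by rewrite /Zp /Zn; case: (leP (Z w) 0); case: (leP (- Z w) 0); lra.
rewrite (E X)// (E Y)//; clear E; congr (_ - _).
  apply: cond_exp_mul_ge0 => //; first by move=> w; rewrite le_max lexx orbT.
  + exact: iM iX mp ZpZ iZX.
  + exact: iM iY mp ZpZ iZY.
apply: cond_exp_mul_ge0 => //; first by move=> w; rewrite le_max lexx orbT.
+ exact: iM iX mn ZnZ iZX.
+ exact: iM iY mn ZnZ iZY.
Qed.

End pull_out.

(** * One step of the iteration *)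

Section level_dot.
Context {R : realType} {q : nat}.
Variable m : nat.
Implicit Types v w : nat -> 'rV[R]_q.

(** A finite real sum in place of the extended-real series [l2normsq]; on the diagonal they agree
    for sequences vanishing from index [m] on. *)
Definition level_dot v w : R := \sum_(i < m) dot (v i) (w i).

Lemma level_dot_ge0 v : 0 <= level_dot v v.
Proof. by apply: sumr_ge0 => i _; exact: dot_ge0. Qed.

Lemma sqr_coord_le_level_dot v (i : 'I_m) j : v i 0 j ^+ 2 <= level_dot v v.
Proof.
apply: le_trans (sqr_coord_le_dot (v i) j) _.
by rewrite /level_dot (bigD1 i)//= lerDl sumr_ge0// => k _; exact: dot_ge0.
Qed.

Lemma level_dot_step v w (c : R) :
  level_dot (fun i => v i - c *: w i) (fun i => v i - c *: w i) =
  level_dot v v + - (2 * c) * level_dot v w + c ^+ 2 * level_dot w w.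
Proof.
rewrite /level_dot !mulr_sumr -!big_split /=; apply: eq_bigr => i _.
by rewrite !dotE (dotC (w i)); ring.
Qed.

End level_dot.

Section level_dot_integral.
Context {d : measure_display} {W : measurableType d} {R : realType} {q : nat}.
Variables (P : probability W R) (m : nat).
Implicit Types X Y : W -> nat -> 'rV[R]_q.

Local Notation integ f := (P.-integrable setT (EFin \o f)).

Lemma level_dot_coord_Lfun2 X :
  (forall (i : 'I_m) j, measurable_fun setT (fun w => X w i 0 j)) ->
  integ (fun w => level_dot m (X w) (X w)) ->
  forall (i : 'I_m) j, (fun w => X w i 0 j) \in Lfun P 2%:E.
Proof.
move=> mX iX i j; apply: integrable_sqr_Lfun2 => //.
apply: (integ_le _ iX); first exact: measurable_funX.
by move=> w; rewrite ger0_norm ?sqr_ge0// sqr_coord_le_level_dot.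
Qed.

Lemma integ_level_dot X Y :
  (forall (i : 'I_m) j, (fun w => X w i 0 j) \in Lfun P 2%:E) ->
  (forall (i : 'I_m) j, (fun w => Y w i 0 j) \in Lfun P 2%:E) ->
  integ (fun w => level_dot m (X w) (Y w)).
Proof.
move=> XL YL; apply: integ_sum => i; apply: integ_sum => j.
exact: Lfun2_mul_integrable.
Qed.

Lemma Rint_level_dot X Y :
  (forall (i : 'I_m) j, (fun w => X w i 0 j) \in Lfun P 2%:E) ->
  (forall (i : 'I_m) j, (fun w => Y w i 0 j) \in Lfun P 2%:E) ->
  \int[P]_w level_dot m (X w) (Y w) =
  \sum_(i < m) \sum_(j < q) \int[P]_w (X w i 0 j * Y w i 0 j).
Proof.
move=> XL YL; rewrite /level_dot /dot Rint_sum => [|i]; last first.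
  by apply: integ_sum => j; exact: Lfun2_mul_integrable.
apply: eq_bigr => i _; rewrite Rint_sum// => j.
exact: Lfun2_mul_integrable.
Qed.

End level_dot_integral.

Section one_step.
Context {d : measure_display} {W : measurableType d} {R : realType} {q : nat}.
Variables (P : probability W R) (G : set (set W)) (m : nat).
Hypotheses (sG : sigma_algebra setT G) (Gm : G `<=` measurable).
Variables e g D : W -> nat -> 'rV[R]_q.
(** In the application [e] is the error [u^k - u_m^*], [D] the truncated gradient,
    [kappa = mu L / (mu + L)], [beta = CG (mu + L)] and [K = L^2]. *)
Variables gamma kappa beta C K : R.

Local Notation integ f := (P.-integrable setT (EFin \o f)).
Local Notation dotm := (level_dot m).

Hypothesis e_wrt : forall (i : 'I_m) j, measurable_wrt G (fun w => e w i 0 j).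
Hypothesis e_int : integ (fun w => dotm (e w) (e w)).
Hypothesis g_mean : forall (i : 'I_m) j,
  is_cond_exp P G (fun w => g w i 0 j) (fun w => D w i 0 j).
Hypothesis D_le : forall w (i : 'I_m) j, D w i 0 j ^+ 2 <= K * dotm (e w) (e w).
Hypothesis D_ge : forall w, kappa * dotm (e w) (e w) <= dotm (e w) (D w).
Variable V : W -> \bar R.
Hypothesis g_V : is_cond_exp_ge0 P G (fun w => (dotm (g w) (g w))%:E) V.
Hypothesis V_le : {ae P, forall w, (V w <=
  (C + beta * (dotm (e w) (D w) - kappa * dotm (e w) (e w)))%:E)%E}.
Hypotheses (gamma_gt0 : 0 < gamma) (C_ge0 : 0 <= C) (beta_ge0 : 0 <= beta).
Hypothesis gamma_le : gamma * beta <= 2.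

Let eL (i : 'I_m) j : (fun w => e w i 0 j) \in Lfun P 2%:E.
Proof.
by apply: level_dot_coord_Lfun2 => // *; exact/(measurable_wrtW Gm)/e_wrt.
Qed.

Let DL (i : 'I_m) j : (fun w => D w i 0 j) \in Lfun P 2%:E.
Proof.
have mD : measurable_fun setT (fun w => D w i 0 j).
  by case: (g_mean i j) => _ /integ_meas.
apply: integrable_sqr_Lfun2 => //.
apply: (integ_le _ (integZl K e_int)); first exact: measurable_funX.
by move=> w; rewrite ger0_norm ?sqr_ge0.
Qed.

(** The excess in the monotonicity bound [D_ge]; the second moment of [g] is controlled by it. *)
Let A w := dotm (e w) (D w) - kappa * dotm (e w) (e w).

Let iA : integ A.
Proof. by apply: integB; [exact: integ_level_dot | exact: integZl]. Qed.

Let A_ge0 w : 0 <= A w. Proof. by rewrite subr_ge0. Qed.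

Let iCA : integ (fun w => C + beta * A w).
Proof.
apply: integD; last exact: integZl.
exact: (@finite_measure_integrable_cst _ _ _ P setT C).
Qed.

(** The whole space belongs to [G], so [|g|^2] and [V] have the same integral. The inequality is
    stated in extended reals because the integrability of [|g|^2] is deduced from it. *)
Let int_g_le :
  (\int[P]_w (dotm (g w) (g w))%:E <= \int[P]_w (C + beta * A w)%:E)%E.
Proof.
case: g_V => mg g0 V0 mV gV.
have GT : G setT by case: sG => G0 GC _; rewrite -(setD0 setT); exact: GC.
rewrite (gV _ GT); apply: ae_ge0_le_integral => //.
- exact: (measurable_wrtW Gm mV).
- by move=> w _; rewrite lee_fin addr_ge0// mulr_ge0.
- exact: measurable_int iCA.
- by apply: filterS V_le.
Qed.

Let ig : integ (fun w => dotm (g w) (g w)).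
Proof.
case: g_V => mg g0 V0 mV gV; apply/integrableP; split=> //=.
rewrite (eq_integral (fun w => (dotm (g w) (g w))%:E)); last first.
  by move=> w _ /=; rewrite ger0_norm// level_dot_ge0.
apply: le_lt_trans int_g_le _.
by have := integrable_lty measurableT iCA.
Qed.

Let gL (i : 'I_m) j : (fun w => g w i 0 j) \in Lfun P 2%:E.
Proof.
apply: level_dot_coord_Lfun2 => // k l.
by case: (g_mean k l) => /integ_meas.
Qed.

Lemma one_step_integrable :
  integ (fun w => dotm (fun i => e w i - gamma *: g w i)
                       (fun i => e w i - gamma *: g w i)).
Proof.
apply: (@integ_eq _ _ _ _ (fun w => dotm (e w) (e w) +
  - (2 * gamma) * dotm (e w) (g w) + gamma ^+ 2 * dotm (g w) (g w))).
  by move=> w; rewrite level_dot_step.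
apply: integD; last exact: integZl.
by apply: integD => //; apply: integZl; exact: integ_level_dot.
Qed.

(** Expand the square. Since [e] is measurable for [G], [g] may be replaced by [D] in the cross
    term, which becomes [- 2 gamma (kappa E|e|^2 + E A)]. The second moment contributes at most
    [gamma^2 C + gamma^2 beta E A], and [gamma * beta <= 2] lets the terms in [E A] be dropped. *)
Lemma one_step_le :
  \int[P]_w dotm (fun i => e w i - gamma *: g w i)
                 (fun i => e w i - gamma *: g w i) <=
  (1 - 2 * gamma * kappa) * \int[P]_w dotm (e w) (e w) + gamma ^+ 2 * C.
Proof.
have ieg : integ (fun w => dotm (e w) (g w)) by exact: integ_level_dot.
have ieD : integ (fun w => dotm (e w) (D w)) by exact: integ_level_dot.
have egD : \int[P]_w dotm (e w) (g w) = \int[P]_w dotm (e w) (D w).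
  rewrite !Rint_level_dot//; apply: eq_bigr => i _; apply: eq_bigr => j _.
  by apply: (cond_exp_mul sG Gm) => //; exact: Lfun2_mul_integrable.
have IA : \int[P]_w A w =
    \int[P]_w dotm (e w) (D w) - kappa * \int[P]_w dotm (e w) (e w).
  by rewrite RintegralB ?RintegralZl//; exact: integZl.
have IA0 : 0 <= \int[P]_w A w by exact: Rintegral_ge0.
have Ig : \int[P]_w dotm (g w) (g w) <= C + beta * \int[P]_w A w.
  have -> : C + beta * \int[P]_w A w = \int[P]_w (C + beta * A w).
    rewrite RintegralD//; last exact: integZl.
      by rewrite Rintegral_cst// [X in fine X]probability_setT mulr1 RintegralZl.
    exact: (@finite_measure_integrable_cst _ _ _ P setT C).
  by apply: fine_le => //; exact: integrable_fin_num.
under eq_Rintegral do rewrite level_dot_step.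
rewrite RintegralD//; [|by apply: integD => //; exact: integZl|exact: integZl].
rewrite RintegralD//; last exact: integZl.
rewrite !RintegralZl// egD.
have g2 : 0 <= gamma ^+ 2 by exact: sqr_ge0.
have h1 := ler_wpM2l g2 Ig.
have h2 := ler_wpM2r (mulr_ge0 (ltW gamma_gt0) IA0) gamma_le.
move: h1 h2; rewrite IA.
set a := \int[P]_w dotm (e w) (D w); set b := \int[P]_w dotm (e w) (e w).
set c := \int[P]_w dotm (g w) (g w); lra.
Qed.

End one_step.

(** * The sigma-algebras of past randomness *)

Section past_theory.
Context {dW : measure_display} {W : measurableType dW}.
Context {dS : nat -> measure_display} {S : forall j, measurableType (dS j)}.
Variable xi : forall j, W -> S j.

Lemma past_sigma_algebra k : sigma_algebra setT (past xi k).
Proof. exact: smallest_sigma_algebra. Qed.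

Lemma past_measurable k : (forall j, measurable_fun setT (xi j)) ->
  past xi k `<=` measurable.
Proof.
move=> mxi; apply: smallest_sub; first exact: sigma_algebra_measurable.
by move=> _ [j _ [A mA <-]]; exact: mxi.
Qed.

Lemma past_mono k l : (k <= l)%N -> past xi k `<=` past xi l.
Proof.
move=> kl; apply: smallest_sub; first exact: smallest_sigma_algebra.
apply: subset_trans (@sub_sigma_algebra _ _ _).
by move=> A [j /= /andP[j0 jk] jA]; exists j => //=; rewrite j0 (leq_trans jk).
Qed.

End past_theory.

(** * The error at level [m], seen as a function in [L^2_pi] *)

Section level_error.
Context {d : measure_display} {T : measurableType d} {R : realType} {q : nat}.
Variables (pi : probability T R) (f : 'rV[R]_q -> T -> R) (B : nat -> T -> R).
Hypothesis B_basis : orthonormal_basis pi B.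
Hypothesis f_diff : forall t (y : 'rV[R]_q), differentiable (f ^~ t) y.
Hypothesis f_meas : forall x : T -> 'rV[R]_q,
  L2 pi x -> measurable_fun setT (fun t => f (x t) t).
Hypothesis f_gradL2 : forall x : T -> 'rV[R]_q, L2 pi x -> L2 pi (grad_at f x).
Variables (mu L : R) (mu_gt0 : 0 < mu) (mu_le : mu <= L).
Hypotheses (f_sc : strongly_convex pi f mu) (f_lip : lipschitz_gradient pi f L).
Variables (m : nat) (us : nat -> 'rV[R]_q) (xs : T -> 'rV[R]_q).
Hypothesis us_opt : level_optimum pi f B m us xs.
Variables (u : nat -> 'rV[R]_q) (x : T -> 'rV[R]_q).
Hypotheses (xu : has_coef pi B x u) (u0 : forall i, (m <= i)%N -> u i = 0).

Let e i := u i - us i.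
Let D := trunc_grad pi f B m x.

Let xL : L2 pi x. Proof. by case: xu. Qed.
Let xsL : L2 pi xs. Proof. by case: us_opt => _ []. Qed.
Let hL : L2 pi (x \- xs). Proof. exact: L2B. Qed.
Let DL : L2 pi (grad_at f x \- grad_at f xs).
Proof. by apply: L2B; exact: f_gradL2. Qed.

Let coef_h i : coef pi B (x \- xs) i = e i.
Proof.
by rewrite coefB//; case: xu => _ ->; case: us_opt => _ [_ ->].
Qed.

Let coef_h0 i : (m <= i)%N -> coef pi B (x \- xs) i = 0.
Proof.
move=> mi; rewrite coef_h /e u0//; case: us_opt => -[_ us0] _ _ _.
by rewrite us0// subrr.
Qed.

(** Below [m] the gradient at the optimum has zero coefficients, so subtracting it changes
    nothing. *)
Let coef_D (i : 'I_m) : coef pi B (grad_at f x \- grad_at f xs) i = D i.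
Proof.
rewrite coefB//; try exact: f_gradL2.
case: us_opt => _ _ /(congr1 (fun F => F (i : nat))) + _.
by rewrite /D /trunc_grad ltn_ord => ->; rewrite subr0.
Qed.

Lemma level_error_norm : level_dot m e e = norm_pi pi (x \- xs) ^+ 2.
Proof.
rewrite sqr_norm_pi (inner_finite_coef B_basis hL hL coef_h0).
by apply: eq_bigr => i _; rewrite coef_h.
Qed.

Lemma level_error_inner :
  level_dot m e D = inner pi (grad_at f x \- grad_at f xs) (x \- xs).
Proof.
have -> : inner pi (grad_at f x \- grad_at f xs) (x \- xs) =
          inner pi (x \- xs) (grad_at f x \- grad_at f xs).
  by apply: eq_Rintegral => t _; exact: dotC.
rewrite (inner_finite_coef B_basis hL DL coef_h0).
by apply: eq_bigr => i _; rewrite coef_h coef_D.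
Qed.

(** Cocoercivity solved for the gradient term: the quantity in the moment assumption is at most
    [mu + L] times the excess [A] of the one-step estimate. *)
Lemma level_error_cocoercive :
  norm_pi pi (grad_at f x \- grad_at f xs) ^+ 2 <=
  (mu + L) * (level_dot m e D - mu * L / (mu + L) * level_dot m e e).
Proof.
have := cocoercive f_gradL2 f_diff f_meas mu_gt0 mu_le f_sc f_lip xL xsL.
rewrite level_error_inner level_error_norm.
have muL : mu + L != 0 by rewrite gt_eqF// addr_gt0// (lt_le_trans mu_gt0).
set n := norm_pi _ (_ \- xs) ^+ 2 => H.
have -> : (mu + L) * (inner pi (grad_at f x \- grad_at f xs) (x \- xs) -
    mu * L / (mu + L) * n) =
  (mu + L) * inner pi (grad_at f x \- grad_at f xs) (x \- xs) - mu * L * n.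
  by field.
by rewrite lerBrDr.
Qed.

Lemma level_error_monotone :
  mu * L / (mu + L) * level_dot m e e <= level_dot m e D.
Proof.
rewrite -subr_ge0 -(pmulr_rge0 _ (_ : 0 < mu + L)).
  by rewrite (le_trans _ level_error_cocoercive) ?sqr_ge0.
by rewrite addr_gt0// (lt_le_trans mu_gt0).
Qed.

(** Bessel's inequality followed by the Lipschitz bound; it makes the conditional mean of [g] square
    integrable whenever the error is. *)
Lemma sqr_trunc_grad_le (i : 'I_m) j :
  D i 0 j ^+ 2 <= L ^+ 2 * level_dot m e e.
Proof.
rewrite -coef_D (le_trans (sqr_coef_le B_basis _ _ DL))// -sqr_norm_pi.
rewrite level_error_norm -exprMn lerXn2r// ?nnegrE ?sqrtr_ge0//.
  by rewrite mulr_ge0 ?sqrtr_ge0// ltW// (lt_le_trans mu_gt0).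
exact: f_lip.
Qed.

End level_error.

(** * Iteration of the one-step estimate *)

Theorem theorem4p3
  (R : realType) (d q : nat) (q_ge1 : (1 <= q)%N)
  (* the parameter domain, a (nonempty) subset of R^d, and pi on it *)
  (Theta : set (d.-tuple R)) (t0 : Theta)
  (pi : probability (trace_type t0) R)
  (B : nat -> trace_type t0 -> R) (B_basis : orthonormal_basis pi B)
  (* the objective *)
  (f : 'rV[R]_q -> trace_type t0 -> R)
  (f_diff : forall (t : trace_type t0) (y : 'rV[R]_q),
     differentiable (f ^~ t) y)
  (f_meas : forall x : trace_type t0 -> 'rV[R]_q,
     L2 pi x -> measurable_fun setT (fun t => f (x t) t))
  (f_gradL2 : forall x : trace_type t0 -> 'rV[R]_q,
     L2 pi x -> L2 pi (grad_at f x))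
  (mu L : R) (mu_gt0 : 0 < mu)
  (f_sc : strongly_convex pi f mu) (f_lip : lipschitz_gradient pi f L)
  (* the level and its optimum *)
  (m : nat) (us : nat -> 'rV[R]_q) (xs : trace_type t0 -> 'rV[R]_q)
  (us_opt : level_optimum pi f B m us xs)
  (* the probability space, and the random variable xi j used at step j *)
  (dW : measure_display) (W : measurableType dW) (P : probability W R)
  (dS : nat -> measure_display) (S : forall j : nat, measurableType (dS j))
  (xi : forall j : nat, W -> S j)
  (xi_meas : forall j : nat, measurable_fun setT (xi j))
  (* the iteration, for k >= 1 *)
  (gamma : R) (gamma_gt0 : 0 < gamma)
  (u1 : nat -> 'rV[R]_q) (u1_level : l2_level m u1)
  (u g : nat -> W -> nat -> 'rV[R]_q)
  (x : nat -> W -> trace_type t0 -> 'rV[R]_q)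
  (u_init : forall w : W, u 1%N w = u1)
  (u_step : forall k : nat, (1 <= k)%N -> forall (w : W) (i : nat),
     u k.+1 w i = u k w i - gamma *: g k w i)
  (x_coef : forall k : nat, (1 <= k)%N -> forall w : W,
     has_coef pi B (x k w) (u k w))
  (g_level : forall k : nat, (1 <= k)%N -> forall w : W, l2_level m (g k w))
  (g_meas : forall k : nat, (1 <= k)%N -> forall (i : nat) (j : 'I_q),
     measurable_wrt (past xi k.+1) (fun w => g k w i 0 j))
  (g_unbiased : forall k : nat, (1 <= k)%N -> forall (i : nat) (j : 'I_q),
     is_cond_exp P (past xi k) (fun w => g k w i 0 j)
       (fun w => trunc_grad pi f B m (x k w) i 0 j))
  (C CG : R) (C_ge0 : 0 <= C) (CG_ge1 : 1 <= CG)
  (g_moment : forall k : nat, (1 <= k)%N ->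
     exists V : W -> \bar R,
       is_cond_exp_ge0 P (past xi k) (fun w => l2normsq (g k w)) V /\
       {ae P, forall w, (V w <=
          (C + CG * norm_pi pi (grad_at f (x k w) \- grad_at f xs) ^+ 2)%:E)%E})
  (gamma_le : gamma <= 2 / ((mu + L) * CG)) :
  forall k : nat, (1 <= k)%N ->
    (\int[P]_w l2normsq (u k.+1 w \- us)%R <=
       ((1 - 2 * gamma * mu * L / (mu + L)) ^+ k)%:E *
         (l2normsq (u1 \- us)%R
            - ((mu + L) * gamma ^+ 2 * C / (2 * gamma * mu * L))%:E)
       + ((mu + L) * gamma ^+ 2 * C / (2 * gamma * mu * L))%:E)%E.
Proof.
have mu_le : mu <= L by exact: strongly_convex_lipschitz_le f_sc f_lip.
have L_gt0 : 0 < L by exact: lt_le_trans mu_le.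
have muL_gt0 : 0 < mu + L by exact: addr_gt0.
have CG_gt0 : 0 < CG by exact: lt_le_trans CG_ge1.
have us0 i : (m <= i)%N -> us i = 0.
  by case: us_opt => -[_ us0] _ _ _; exact: us0.
have u0 k w i : (m <= i)%N -> u k.+1 w i = 0.
  move=> mi; elim: k => [|k IH]; first by rewrite u_init; case: u1_level => _ ->.
  by rewrite u_step// IH; case: (g_level k.+1 isT w) => _ ->//; rewrite scaler0 subrr.
have u_wrt k i (j : 'I_q) : measurable_wrt (past xi k.+1) (fun w => u k.+1 w i 0 j).
  elim: k => [|k IH].
    rewrite (_ : (fun w => _) = fun=> u1 i 0 j).
      by apply: measurable_wrt_cst; exact: past_sigma_algebra.
    by apply/funext => w; rewrite u_init.
  rewrite (_ : (fun w => _) = fun w => u k.+1 w i 0 j - gamma * g k.+1 w i 0 j).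
    apply: measurable_wrt_step; [exact: past_sigma_algebra| |exact: g_meas].
    by move=> A mA; apply: (past_mono (leqnSn k.+1)); exact: IH.
  by apply/funext => w; rewrite u_step// !mxE.
pose e k w i := u k w i - us i.
have e0 k w i : (m <= i)%N -> e k.+1 w i = 0.
  by move=> mi; rewrite /e u0// us0// subrr.
pose kappa := mu * L / (mu + L).
pose rho := 1 - 2 * gamma * kappa.
(* [K] is the fixed point of the recursion [E := rho E + gamma^2 C], as [KE] records, so the
   distance to [K] contracts by [rho]. *)
pose K := (mu + L) * gamma ^+ 2 * C / (2 * gamma * mu * L).
have gbeta : gamma * (CG * (mu + L)) <= 2.
  by rewrite (mulrC CG) -ler_pdivlMr// mulr_gt0.
have KE : gamma ^+ 2 * C = (1 - rho) * K.
  by rewrite /K /rho /kappa; field; rewrite !gt_eqF.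
(* The induction multiplies a bound by [rho]. As [CG >= 1], [gamma (mu + L) <= 2], so [2 gamma kappa
   <= 4 mu L / (mu + L)^2 <= 1]. *)
have rho_ge0 : 0 <= rho.
  have g2 : gamma * (mu + L) <= 2.
    apply: le_trans gbeta; rewrite ler_wpM2l ?(ltW gamma_gt0)//.
    by rewrite ler_peMl// ltW.
  rewrite subr_ge0 /kappa mulrA ler_pdivrMr// mul1r.
  have s1 := ler_wpM2r (ltW (mulr_gt0 mu_gt0 L_gt0)) g2.
  have s2 : 4 * mu * L <= (mu + L) ^+ 2 by have := sqr_ge0 (mu - L); lra.
  rewrite -(ler_pM2r muL_gt0).
  by move: s1 s2; lra.
(* Integrability is carried along, since the one-step estimate requires it. The index is shifted:
   [k = 0] concerns the deterministic [u 1], where the bound is an equality. *)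
have main k :
    P.-integrable setT (EFin \o (fun w => level_dot m (e k.+1 w) (e k.+1 w))) /\
    \int[P]_w level_dot m (e k.+1 w) (e k.+1 w) <=
    rho ^+ k * (level_dot m (u1 \- us) (u1 \- us) - K) + K.
  elim: k => [|k [iE leE]].
    have E1 w : e 1%N w = u1 \- us by rewrite /e u_init.
    under [X in EFin \o X]eq_fun do rewrite E1.
    under eq_Rintegral do rewrite E1.
    split; first exact: (@finite_measure_integrable_cst _ _ _ P setT _).
    by rewrite Rintegral_cst// [X in fine X]probability_setT mulr1 expr0 mul1r subrK.
  have [V [gV V_le]] := g_moment k.+1 isT.
  have eS w : e k.+2 w = fun i => e k.+1 w i - gamma *: g k.+1 w i.
    by apply/funext => i; rewrite /e u_step// addrAC.
  have gV' : is_cond_exp_ge0 P (past xi k.+1)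
      (fun w => (level_dot m (g k.+1 w) (g k.+1 w))%:E) V.
    rewrite (_ : (fun w => _) = fun w => l2normsq (g k.+1 w))//.
    apply/funext => w; rewrite (@l2normsq_finite _ _ _ m)//.
    by case: (g_level k.+1 isT w).
  have coco w := level_error_cocoercive B_basis f_diff f_meas f_gradL2 mu_gt0 mu_le
    f_sc f_lip us_opt (x_coef k.+1 isT w) (u0 k w).
  have V_le' : {ae P, forall w, (V w <= (C + CG * (mu + L) *
      (level_dot m (e k.+1 w) (trunc_grad pi f B m (x k.+1 w)) -
        kappa * level_dot m (e k.+1 w) (e k.+1 w)))%:E)%E}.
    apply: filterS V_le => w /le_trans; apply.
    by rewrite lee_fin lerD2l -mulrA ler_wpM2l ?coco// ltW.
  have e_wrt (i : 'I_m) j : measurable_wrt (past xi k.+1) (fun w => e k.+1 w i 0 j).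
    rewrite (_ : (fun w => _) = fun w => u k.+1 w i 0 j - 1 * us i 0 j).
      apply: measurable_wrt_step; [exact: past_sigma_algebra|exact: u_wrt|].
      by apply: measurable_wrt_cst; exact: past_sigma_algebra.
    by apply/funext => w; rewrite !mxE mul1r.
  have D_le w (i : 'I_m) j : trunc_grad pi f B m (x k.+1 w) i 0 j ^+ 2 <=
      L ^+ 2 * level_dot m (e k.+1 w) (e k.+1 w).
    exact: (sqr_trunc_grad_le B_basis f_gradL2 mu_gt0 mu_le f_lip us_opt
      (x_coef k.+1 isT w) (u0 k w)).
  have D_ge w : kappa * level_dot m (e k.+1 w) (e k.+1 w) <=
      level_dot m (e k.+1 w) (trunc_grad pi f B m (x k.+1 w)).
    exact: (level_error_monotone B_basis f_diff f_meas f_gradL2 mu_gt0 mu_le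
      f_sc f_lip us_opt (x_coef k.+1 isT w) (u0 k w)).
  have sG := past_sigma_algebra xi k.+1.
  have Gm := @past_measurable _ _ _ _ xi k.+1 xi_meas.
  have g_mean (i : 'I_m) j := g_unbiased k.+1 isT i j.
  have beta0 : 0 <= CG * (mu + L) by rewrite mulr_ge0// ltW.
  have iS := one_step_integrable sG Gm gamma e_wrt iE g_mean D_le D_ge gV' V_le'
    C_ge0 beta0.
  have leS := one_step_le sG Gm e_wrt iE g_mean D_le D_ge gV' V_le'
    gamma_gt0 C_ge0 beta0 gbeta.
  under [X in EFin \o X]eq_fun do rewrite eS.
  under eq_Rintegral do rewrite eS.
  split => //; apply: (le_trans leS).
  rewrite -/rho KE exprS -mulrA; move: (ler_wpM2l rho_ge0 leE); lra.
move=> [//|k] _; have [iE leE] := main k.+1.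
(* All errors vanish from index [m] on, so the extended-real norms reduce to finite sums and the
   claim to a real inequality. *)
rewrite (eq_integral (fun w => (level_dot m (e k.+2 w) (e k.+2 w))%:E)); last first.
  by move=> w _; rewrite (@l2normsq_finite _ _ _ m)//; exact: e0.
rewrite (@l2normsq_finite _ _ (u1 \- us) m); last first.
  by move=> i mi /=; case: u1_level => _ ->//; rewrite us0// subrr.
rewrite -[leLHS]fineK ?(integrable_fin_num _ iE)//.
rewrite -EFinB -EFinM -EFinD lee_fin.
have -> : 1 - 2 * gamma * mu * L / (mu + L) = rho by rewrite /rho /kappa !mulrA.
exact: leE.
Qed.
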